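(* The following pairs of graph parameters are functionally equivalent: (i) component twin-width and rank-width; (ii) total twin-width and linear rank-width. That is, there is a function $f:\mathbb N\to\mathbb N$ such that for every finite graph $G$: $\mathrm{ltww}(G)\le f(\mathrm{rw}(G))$, $\mathrm{rw}(G)\le f(\mathrm{ltww}(G))$, $\mathrm{ttww}(G)\le f(\mathrm{lrw}(G))$ and $\mathrm{lrw}(G)\le f(\mathrm{ttww}(G))$, where $\mathrm{rw}$, $\mathrm{lrw}$, $\mathrm{ltww}$, $\mathrm{ttww}$ denote rank-width, linear rank-width, component twin-width and total twin-width.
   Context: Graphs are finite and simple. Two parameters $w,w'$ are functionally equivalent if there is a function $f$ with $w(G)\le f(w'(G))$ and $w'(G)\le f(w(G))$ for all graphs $G$. Partition sequences: for an $n$-vertex graph $G$, a partition sequence is a sequence $\mathcal P_n,\dots,\mathcal P_1$ of partitions of $V(G)$ where $\mathcal P_n$ is the partition into singletons, $\mathcal P_1=\{V(G)\}$, and each $\mathcal P_i$ ($i<n$) is obtained from $\mathcal P_{i+1}$ by merging two parts. Two disjoint vertex sets $X,Y$ are homogeneous if either all pairs $x\in X,y\in Y$ are edges or none is. For a partition $\mathcal P$ of $V(G)$, the quotient trigraph $G/\mathcal P$ has vertex set $\mathcal P$; two distinct parts $X,Y$ are joined by a red edge if they are not homogeneous; moreover every part with at least two vertices carries a red loop (counted as one red edge). The red graph of $G/\mathcal P$ is the graph on $\mathcal P$ formed by the red edges. Component twin-width $\mathrm{ltww}(G)$ is the minimum, over all partition sequences, of $\max_i$ (maximum number of parts in a connected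 component of the red graph of $G/\mathcal P_i$). Total twin-width $\mathrm{ttww}(G)$ is the minimum, over all partition sequences, of $\max_i$ (total number of red edges, loops included, of $G/\mathcal P_i$). Rank-width: a branch decomposition of $G$ is a tree whose internal nodes have degree 3 and whose leaves are in bijection with $V(G)$; each tree edge $e$ induces a bipartition $(A,B)$ of $V(G)$ via the leaf sets of the two components of the tree minus $e$, whose value is the rank over $\mathbb F_2$ of the $A\times B$ adjacency matrix. The width of the decomposition is the maximum value over its edges, and rank-width is the minimum width over all branch decompositions. Linear rank-width is defined the same way, restricting to branch decompositions whose internal nodes form a path. *)

(* Defs.v *)
From HB Require Import structures.
From mathcomp Require Import all_boot all_order all_algebra.
From mathcomp Require Import boolp zify.

Set Implicit Arguments.
Unset Strict Implicit.
Unset Printing Implicit Defensive.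

Import GRing.Theory.

Record sgraph := SGraph {
  vertex :> finType;
  adj : rel vertex;
  adj_sym : symmetric adj;
  adj_irr : irreflexive adj }.

Section NatMin.
Variables (P : nat -> Prop) (exP : exists n, P n).

Lemma nat_min_subproof : exists n, (fun k => `[< P k >]) n.
Proof. by case: exP => n Pn; exists n; apply/asboolP. Qed.

Definition nat_min : nat := ex_minn nat_min_subproof.

Lemma nat_minP : P nat_min /\ forall m, P m -> nat_min <= m.
Proof.
rewrite /nat_min; case: ex_minnP => m /asboolP Pm min_m.
by split=> // k Pk; apply/min_m/asboolP.
Qed.

End NatMin.

Section PartitionSequences.
Variable G : sgraph.
Implicit Types X Y : {set G}.

Definition homogeneous X Y : bool :=
  [forall x in X, forall y in Y, adj x y] ||
  [forall x in X, forall y in Y, ~~ adj x y].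

Definition red (P : {set {set G}}) : rel {set G} := fun X Y =>
  [&& X \in P, Y \in P & if X == Y then 1 < #|X| else ~~ homogeneous X Y].

(* An edge is the set of its ends, so a loop at X is the singleton [set X]. *)
Definition red_edges (P : {set {set G}}) : {set {set {set G}}} :=
  [set [set X; Y] | X in P, Y in P & red P X Y].

Definition red_component (P : {set {set G}}) X : {set {set G}} :=
  [set Y in P | connect (red P) X Y].

Definition merge_of (P Q : {set {set G}}) : Prop :=
  exists X Y, [/\ X \in P, Y \in P, X != Y
                & Q = (X :|: Y) |: (P :\: [set X; Y])].

(* P i is meaningful for 1 <= i <= #|G| only; the null graph has (vacuous)
   partition sequences, and both of its twin-width parameters are 0. *)
Record partition_sequence (P : nat -> {set {set G}}) : Prop := {
  pseq_partition : forall i, 1 <= i <= #|G| -> partition (P i) [set: G];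
  pseq_start : P #|G| = [set [set x] | x : G];
  pseq_end : P 1 = [set [set: G]];
  pseq_merge : forall i, 1 <= i < #|G| -> merge_of (P i.+1) (P i) }.

Definition component_width (P : nat -> {set {set G}}) : nat :=
  \max_(1 <= i < #|G|.+1) \max_(X in P i) #|red_component (P i) X|.

Definition total_width (P : nat -> {set {set G}}) : nat :=
  \max_(1 <= i < #|G|.+1) #|red_edges (P i)|.

Lemma partition_merge (P : {set {set G}}) X Y : partition P [set: G] ->
  X \in P -> Y \in P -> X != Y ->
  let Q := (X :|: Y) |: (P :\: [set X; Y]) in
  partition Q [set: G] /\ #|Q|.+1 = #|P|.
Proof.
case/and3P => /eqP covP trP nP0 XP YP XY Q.
have disj Z : Z \in P -> Z \notin [set X; Y] -> [disjoint X :|: Y & Z].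
  move=> ZP; rewrite !inE negb_or => /andP[ZX ZY].
  rewrite -setI_eq0 setIUl setU_eq0 !setI_eq0.
  by rewrite !(trivIsetP trP) // eq_sym.
have X0 : X != set0 by apply: contraNneq nP0 => <-.
have XYQ : X :|: Y \notin P :\: [set X; Y].
  apply/negP; rewrite inE => /andP[h hP]; have := disj _ hP h.
  by rewrite -setI_eq0 setIid setU_eq0 (negbTE X0).
split; last first.
  rewrite cardsU1 XYQ cardsD (setIidPr _); last first.
    by apply/subsetP => Z; rewrite !inE => /orP[]/eqP->.
  have : #|[set X; Y]| <= #|P|.
    by apply/subset_leq_card/subsetP => Z; rewrite !inE => /orP[]/eqP->.
  by rewrite cards2 XY /= => P2; rewrite add1n -addn2 subnK.
apply/and3P; split.
- apply/eqP/setP => x; rewrite in_setT; have := in_setT x.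
  rewrite -covP => /bigcupP[Z ZP xZ]; apply/bigcupP.
  have [ZXY|ZXY] := boolP (Z \in [set X; Y]).
    exists (X :|: Y); first by rewrite !inE eqxx.
    by move: ZXY xZ; rewrite !inE => /orP[]/eqP-> ->; rewrite ?orbT.
  by exists Z => //; rewrite /Q in_setU1 in_setD ZXY ZP orbT.
- apply/trivIsetP => A B; rewrite /Q !in_setU1 !in_setD.
  case/orP=> [/eqP->|/andP[hA AP]] /orP[/eqP->|/andP[hB BP]] AB.
  + by rewrite eqxx in AB.
  + exact: disj.
  + by rewrite disjoint_sym; apply: disj.
  + exact: (trivIsetP trP).
- rewrite /Q in_setU1 in_setD (negbTE nP0) andbF orbF eq_sym setU_eq0.
  by rewrite (negbTE X0).
Qed.

Lemma ex_partition_sequence : exists P, partition_sequence P.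
Proof.
have [n0|n_gt0] := posnP #|G|.
  exists (fun i => if i == 0 then [set [set x] | x : G] else [set [set: G]]).
  by split; rewrite ?n0 //; lia.
suff main k (Q : {set {set G}}) : 0 < k -> #|Q| = k ->
    partition Q [set: G] -> exists P,
    [/\ P k = Q, P 1 = [set [set: G]],
      forall i, 1 <= i <= k -> partition (P i) [set: G]
    & forall i, 1 <= i < k -> merge_of (P i.+1) (P i)].
  have cS : #|[set [set x] | x : G]| = #|G|.
    by rewrite card_imset //; apply: set1_inj.
  have [|P [P1 P2 P3 P4]] := main _ _ n_gt0 cS.
    apply/and3P; split.
    - apply/eqP/setP => x; rewrite in_setT; apply/bigcupP.
      by exists [set x]; rewrite ?set11 // imset_f.
    - apply/trivIsetP => _ _ /imsetP[x _ ->] /imsetP[y _ ->] xy.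
      by rewrite disjoints1 inE; apply: contraNneq xy => ->.
    - apply/negP => /imsetP[x _ /setP/(_ x)].
      by rewrite !inE eqxx.
  by exists P; split.
elim: k Q => // k IH Q _ cQ pQ.
case: k IH cQ => [_|k IH] cQ.
  move/eqP/cards1P: cQ pQ => [X ->] pX.
  have XT : X = [set: G] by rewrite -(cover_partition pX) /cover big_set1.
  by exists (fun _ => [set X]); split=> [||//|i]; rewrite ?XT //; lia.
have : 1 < #|Q| by rewrite cQ.
case/card_gt1P=> X [Y [XQ YQ XY]].
have [pQ' cQ'] := partition_merge pQ XQ YQ XY.
move: pQ' cQ'; set Q' := (_ |: _) => pQ' cQ'.
have [//||//|P [Pk P1 Pp Pm]] := IH Q'; first by move: cQ'; rewrite cQ => -[].
exists (fun i => if i == k.+2 then Q else P i); split; rewrite ?eqxx //.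
- by move=> i /andP[i1 ik]; case: eqP => // ik2; apply: Pp; lia.
- move=> i /andP[i1 ik]; have -> : (i == k.+2) = false by lia.
  case: eqP => [[->]|ik2]; last by apply: Pm; lia.
  by rewrite Pk; exists X, Y.
Qed.

Lemma ex_component_width :
  exists k, exists2 P, partition_sequence P & component_width P = k.
Proof. by case: ex_partition_sequence => P hP; exists (component_width P), P. Qed.

Lemma ex_total_width :
  exists k, exists2 P, partition_sequence P & total_width P = k.
Proof. by case: ex_partition_sequence => P hP; exists (total_width P), P. Qed.

Definition ltww : nat := nat_min ex_component_width.
Definition ttww : nat := nat_min ex_total_width.

End PartitionSequences.

Section Trees.
Variables (N : finType) (t : rel N).

(* ucycle also holds of the sequences [::] and [:: x; y] with t x y. *)
Record is_tree : Prop := {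
  tree_sym : symmetric t;
  tree_irr : irreflexive t;
  tree_connected : forall x y, connect t x y;
  tree_acyclic : forall c : seq N, ucycle t c -> size c <= 2 }.

Definition degree (x : N) : nat := #|[set y | t x y]|.

(* The only node of a one-node tree, of degree 0, counts as a leaf. *)
Definition leaf (x : N) : bool := degree x <= 1.
Definition internal (x : N) : bool := ~~ leaf x.

Definition del_edge (a b : N) : rel N := fun x y =>
  t x y && ([set x; y] != [set a; b]).

Definition internal_path : Prop :=
  exists p : seq N, [/\ uniq p, p =i internal
    & forall x0 i j, i < size p -> j < size p ->
        t (nth x0 p i) (nth x0 p j) = (i.+1 == j) || (j.+1 == i)].

End Trees.

(* The tree without nodes is allowed: it decomposes exactly the null graph,
   since every nonempty tree has a leaf. *)
Record branch_decomposition (G : sgraph) := BranchDecomposition {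
  node : finType;
  tadj : rel node;
  leaf_of : G -> node;
  bd_tree : is_tree tadj;
  bd_cubic : forall x, internal tadj x -> degree tadj x = 3;
  bd_inj : injective leaf_of;
  bd_leaves : forall x, leaf tadj x <-> exists v, leaf_of v = x }.

Section RankWidth.
Variable G : sgraph.
Implicit Type D : branch_decomposition G.

Definition cut_rank (A B : {set G}) : nat :=
  \rank (\matrix_(i < #|A|, j < #|B|)
           (adj (enum_val i) (enum_val j))%:R : 'M['F_2]_(#|A|, #|B|))%R.

(* The leaves in the component of a once the edge {a, b} is deleted. *)
Definition side D (a b : node D) : {set G} :=
  [set v | connect (del_edge (tadj (b := D)) a b) a (leaf_of D v)].

Definition rank_width_of D : nat :=
  \max_(e : node D * node D | tadj e.1 e.2)
     cut_rank (side e.1 e.2) (side e.2 e.1).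

Definition linear_decomposition D : Prop := internal_path (tadj (b := D)).

Section Caterpillar.
Let n := #|G|.
Let m := if n <= 1 then n else n.-1.*2.
Let N : finType := 'I_m.
Let par k := if k <= 1 then 0 else if odd k then k - 2 else k.-1.
Let t : rel N := fun x y =>
  (0 < y) && (x == par y :> nat) || (0 < x) && (y == par x :> nat).

Let par_lt k : 0 < k -> par k < k.
Proof. by rewrite /par; case: ifP => ?; [|case: ifP => ?]; lia. Qed.

Let t_sym : symmetric t.
Proof. by move=> x y; rewrite /t orbC. Qed.

Let t_le x y : t x y -> y <= x -> y = par x :> nat.
Proof.
case/orP=> /andP[h /eqP e] // yx.
by have := par_lt h; rewrite -e; lia.
Qed.

Let t_irr : irreflexive t.
Proof.
move=> x; apply/negP; rewrite /t orbb => /andP[h /eqP e].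
by have := par_lt h; rewrite -e ltnn.
Qed.

Let caterpillar_tree : is_tree t.
Proof.
have csym := sym_connect_sym t_sym.
split => //.
- have root : forall k (x : N) , x <= k -> forall z : N, z = 0 :> nat -> connect t x z.
    elim=> [|k IH] x xk z z0.
      by rewrite (_ : x = z) //; apply: val_inj => /=; lia.
    have [x0|x0] := posnP x; first by apply: IH => //; lia.
    have px : par x < m by apply: leq_trans (ltn_ord x); have := par_lt x0; lia.
    apply: (@connect_trans _ _ (Ordinal px)).
      by apply: connect1; rewrite /t /= x0 eqxx orbT.
    by apply: IH => //=; have := par_lt x0; lia.
  move=> x y; have m0 : 0 < m by apply: leq_ltn_trans (ltn_ord x).
  apply: (@connect_trans _ _ (Ordinal m0)); first exact: (root x).
  by rewrite csym; apply: (root y).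
- move=> c /andP[cyc uc]; rewrite leqNgt; apply/negP => sc.
  case: c cyc uc sc => // x0 c0; set c := x0 :: c0 => cyc uc sc.
  have x0c : x0 \in c by rewrite inE eqxx.
  have [x xc xmax] := arg_maxnP (fun i : N => i : nat) x0c.
  have [i s rs] := rot_to xc.
  move: cyc; rewrite -(rot_cycle i) rs => cyc.
  have us : uniq (x :: s) by rewrite -rs rot_uniq.
  have ss : 2 < size (x :: s) by rewrite -rs size_rot.
  have smax z : z \in x :: s -> z <= x by rewrite -rs mem_rot => /xmax.
  case: s {rs} cyc us ss smax => // y s.
  elim/last_ind: s => // s z _ /= + us _ smax.
  case/andP=> xy; rewrite rcons_path last_rcons => /andP[_ zx].
  rewrite t_sym in zx.
  have ey : y = par x :> nat.
    by apply: (t_le xy); apply: smax; rewrite !inE eqxx orbT.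
  have ez : z = par x :> nat.
    by apply: (t_le zx); apply: smax; rewrite !inE mem_rcons inE eqxx !orbT.
  have yz : y = z by apply: val_inj; rewrite /= ey ez.
  by case/and3P: us => _ + _; rewrite yz mem_rcons inE eqxx.
Qed.

Let lab_subproof (v : G) :
  (if enum_rank v == n.-1 :> nat then m.-1 else (enum_rank v).*2) < m.
Proof.
have := ltn_ord (enum_rank v); rewrite -/n /m.
by move: (nat_of_ord _) => k kn; repeat case: ifP => ?; lia.
Qed.
Let lab v : N := Ordinal (lab_subproof v).

Let lab_inj : injective lab.
Proof.
move=> u v /(congr1 val) /=.
have := ltn_ord (enum_rank u); have := ltn_ord (enum_rank v); rewrite -/n => hv hu h.
apply/enum_rank_inj/val_inj => /=.
move: hu hv h; move: (nat_of_ord (enum_rank u)) (nat_of_ord (enum_rank v)) => i j.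
by rewrite /m; repeat case: ifP => ?; lia.
Qed.

Let outer (x : N) := ~~ odd x || (x == m.-1 :> nat).

Let outer_lab x : outer x <-> exists v, lab v = x.
Proof.
split=> [ox|[v <-]]; last first.
  by rewrite /outer /=; case: ifP => _; rewrite ?eqxx ?orbT ?odd_double.
have xm := ltn_ord x.
pose k := if x == m.-1 :> nat then n.-1 else x./2.
have kn : k < #|G|.
  rewrite -/n /k; move: xm ox; rewrite /outer /m.
  by move: (nat_of_ord x) => j; repeat case: ifP => ?; lia.
exists (enum_val (Ordinal kn)); apply: val_inj; rewrite /= enum_valK /= /k.
move: xm ox kn; rewrite -/n /k /outer.
move: (nat_of_ord x) => j; case: (j =P m.-1) => [->|]; first by rewrite eqxx.
rewrite orbF => jm jm1 oj kn.
have -> : (j./2 == n.-1) = false.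
  by move: jm jm1; rewrite /m; case: ifP; lia.
by lia.
Qed.

Let outer_leaf x : outer x -> leaf t x.
Proof.
move=> ox; apply/card_le1_eqP => y z; rewrite !inE => xy xz.
apply: val_inj; have := ltn_ord x; have := ltn_ord y; have := ltn_ord z.
move: ox xy xz; rewrite /outer /t /par /m /=.
move: (nat_of_ord x) (nat_of_ord y) (nat_of_ord z) => i j k.
by repeat case: ifP => ?; lia.
Qed.

Let inner_degree x : ~~ outer x -> degree t x = 3.
Proof.
move=> ox; have xm := ltn_ord x.
have h1 : x.+1 < m.
  by move: ox xm; rewrite /outer; move: (nat_of_ord x) => i; lia.
have h2 : x.+2 < m.
  move: ox xm h1; rewrite /outer /m; move: (nat_of_ord x) => i.
  by case: ifP; lia.
have x0 : 0 < x by move: ox; rewrite /outer; move: (nat_of_ord x) => i; lia.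
have px : par x < m by apply: leq_trans xm; have := par_lt x0; lia.
pose s : seq N := [:: Ordinal px; Ordinal h1; Ordinal h2].
have us : uniq s.
  rewrite /s /= !inE -!val_eqE /=; have := par_lt x0.
  by move: (par x) => a; move: (nat_of_ord x) => b; lia.
rewrite /degree cardsE (_ : 3 = size s) // -(card_uniqP us).
apply: eq_card => y; rewrite !inE -!val_eqE /= unfold_in /=.
move: ox x0; rewrite /outer /t /par.
move: (nat_of_ord x) (nat_of_ord y) => i j.
by repeat case: ifP => ?; lia.
Qed.

Let leafE x : leaf t x = outer x.
Proof.
have [/outer_leaf//|/inner_degree d] := boolP (outer x).
by rewrite /leaf d.
Qed.

Definition caterpillar : branch_decomposition G.
Proof.
refine (@BranchDecomposition G N t lab caterpillar_tree _ lab_inj _).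
- by move=> x; rewrite /internal leafE; apply: inner_degree.
- by move=> x; rewrite leafE; apply: outer_lab.
Defined.

Let spine_subproof (i : 'I_(n - 2)) : i.*2.+1 < m.
Proof.
have := ltn_ord i; rewrite /m; move: (nat_of_ord i) => k.
by case: ifP; lia.
Qed.

Lemma caterpillar_linear : internal_path (tadj (b := caterpillar)).
Proof.
rewrite /caterpillar /=.
exists [seq (Ordinal (spine_subproof i) : N) | i <- enum 'I_(n - 2)]; split.
- rewrite map_inj_uniq ?enum_uniq // => i j /(congr1 val) /= h.
  by apply: val_inj => /=; lia.
- move=> x; rewrite [RHS]unfold_in /internal leafE; apply/mapP/idP => [[i _ ->]|ox].
    rewrite /outer /=; have := ltn_ord i; rewrite /m.
    by move: (nat_of_ord i) => k; case: ifP; lia.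
  have hx : x./2 < n - 2.
    move: ox (ltn_ord x); rewrite /outer /m; move: (nat_of_ord x) => k.
    by case: ifP; lia.
  exists (Ordinal hx); first by rewrite mem_enum.
  apply: val_inj => /=; move: ox; rewrite /outer.
  by move: (nat_of_ord x) => k; lia.
- move=> x0 i j; rewrite size_map size_enum_ord => hi hj.
  have nthE k (hk : k < n - 2) :
      nth x0 [seq (Ordinal (spine_subproof i) : N) | i <- enum 'I_(n - 2)] k
        = k.*2.+1 :> nat.
    rewrite (nth_map (Ordinal hk)) ?size_enum_ord //=.
    by congr (_.*2.+1); apply: nth_enum_ord.
  rewrite /t !nthE //.
  by rewrite /par; repeat case: ifP => ?; lia.
Qed.

End Caterpillar.

Lemma ex_rank_width : exists k, exists D, rank_width_of D = k.
Proof. by exists (rank_width_of caterpillar), caterpillar. Qed.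

Lemma ex_linear_rank_width :
  exists k, exists2 D, linear_decomposition D & rank_width_of D = k.
Proof.
exists (rank_width_of caterpillar), caterpillar => //.
exact: caterpillar_linear.
Qed.

Definition rw : nat := nat_min ex_rank_width.
Definition lrw : nat := nat_min ex_linear_rank_width.

End RankWidth.

(* Main.v *)
Require Import Defs.
From mathcomp Require Import all_boot all_order all_algebra zify.

Set Implicit Arguments.
Unset Strict Implicit.
Unset Printing Implicit Defensive.

(** Both equivalences pass through vertex sets instead of trees: [branched k A]
    says that A is the root of a binary tree of disjoint unions with cut ranks at
    most k, and [layered k A] that A is reached by adding vertices one at a time
    through sets of cut rank at most k.

    From rank-width to twin-width: a set A of cut rank at most k has at most 2^k
    classes of vertices with equal neighbourhoods outside A.  Contracting each set
    of the tree to these classes, children before parents, never creates a red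
    edge between a part inside A and a part outside A, so a red component lives in
    the at most 2^(k+1) parts of two siblings.

    From twin-width to rank-width: if a family S of parts is closed under red
    edges, then vertices of one part of S agree outside the union of S, so that
    union has cut rank at most the number of parts of S.  The red components of
    the successive partitions are such families, and undoing one merge turns a red
    component into a union of red components with one more part.  For the linear
    version, the parts incident to a red edge (or loop) cover a set which only
    grows along the sequence, by parts which are isolated singletons. *)

(** * Cut rank and merge runs *)

Lemma connect_ind (T : finType) (e : rel T) (x : T) (Q : T -> Prop) :
  Q x -> (forall y z, connect e x y -> Q y -> e y z -> Q z) ->
  forall y, connect e x y -> Q y.
Proof.
move=> Qx QS y /connectP[p + ->]; elim/last_ind: p => //= p z IH.
rewrite rcons_path last_rcons => /andP[xp pz].
by apply: QS (IH xp) pz; apply/connectP; exists p.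
Qed.

Section CutRank.
Variable G : sgraph.
Implicit Types (A B X Y : {set G}) (P : {set {set G}}).

Definition twins_over B X :=
  {in X &, forall x x' : G, {in B, forall y, adj x y = adj x' y}}.

Lemma twins_overS A B X : A \subset B -> twins_over B X -> twins_over A X.
Proof. by move=> /subsetP AB tX x x' xX x'X y /AB; apply: tX. Qed.

Lemma twins_over_set1 B x : twins_over B [set x].
Proof. by move=> y z; rewrite !inE => /eqP-> /eqP->. Qed.

Lemma homogeneous_sym : symmetric (@homogeneous G).
Proof.
suff imp X Y : homogeneous X Y -> homogeneous Y X by move=> X Y;
  apply/idP/idP; apply: imp.
case/orP=> /forall_inP h; apply/orP; [left|right];
  apply/forall_inP=> y yY; apply/forall_inP=> x xX;
  by rewrite adj_sym; apply: (forall_inP (h x xX)).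
Qed.

Lemma red_sym P : symmetric (red P).
Proof.
by move=> X Y; rewrite /red eq_sym homogeneous_sym; case: eqP => [->//|_]; rewrite andbCA.
Qed.

Lemma homogeneousS X Y X' Y' :
  X' \subset X -> Y' \subset Y -> homogeneous X Y -> homogeneous X' Y'.
Proof.
move=> /subsetP sX /subsetP sY /orP[] /forall_inP h; apply/orP; [left|right];
  apply/forall_inP=> x /sX /h /forall_inP hx; apply/forall_inP=> y /sY; exact: hx.
Qed.

(** Fix [x] in [X] and [y] in [Y]: any pair is moved to this one by changing one end and then the
    other, and each change preserves adjacency. *)
Lemma twins_homogeneous X Y : twins_over Y X -> twins_over X Y -> homogeneous X Y.
Proof.
move=> tX tY; have [->|/set0Pn[x xX]] := eqVneq X set0.
  by apply/orP; left; apply/forall_inP=> x; rewrite inE.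
have [->|/set0Pn[y yY]] := eqVneq Y set0.
  by apply/orP; left; apply/forall_inP=> ? _; apply/forall_inP=> z; rewrite inE.
have hE x' y' : x' \in X -> y' \in Y -> adj x' y' = adj x y.
  move=> x'X y'Y; rewrite (tX x' x) // adj_sym [in RHS]adj_sym.
  by rewrite (tY y' y).
apply/orP; case: (boolP (adj x y)) => xy; [left|right];
  by apply/forall_inP=> x' x'X; apply/forall_inP=> y' y'Y; rewrite hE.
Qed.

Lemma homogeneous_set1 (x y : G) : homogeneous [set x] [set y].
Proof. by apply/twins_homogeneous; apply/twins_over_set1. Qed.

Lemma homogeneous_twins X Y : homogeneous X Y -> twins_over Y X.
Proof.
case/orP=> /forall_inP h x x' /h /forall_inP hx /h /forall_inP hx' y yY.
  by rewrite hx // hx'.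
by rewrite (negbTE (hx _ yY)) (negbTE (hx' _ yY)).
Qed.

Lemma cut_rank_sym A B : cut_rank A B = cut_rank B A.
Proof.
rewrite /cut_rank -mxrank_tr; congr (\rank _); apply/matrixP=> i j.
by rewrite !mxE adj_sym.
Qed.

Lemma cut_rank_leq_card A B : cut_rank A B <= #|A|.
Proof. exact: rank_leq_row. Qed.

(** Twins have equal rows, so the row space is spanned by one row per member of [P]. *)
Lemma cut_rank_leq_classes P A B : A \subset cover P ->
  {in P, forall X, twins_over B X} -> cut_rank A B <= #|P|.
Proof.
move=> /subsetP AP tP.
(* The row of a class records adjacency to some member, which avoids choosing a representative;
   twins agree, so it is the row of every member. *)
pose N : 'M['F_2]_(#|P|, #|B|) := (\matrix_(s < #|P|, j < #|B|)
  [exists x in (enum_val s : {set G}), adj x (enum_val j)]%:R)%R.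
apply: leq_trans (rank_leq_row N); apply: mxrankS; apply/row_subP => i.
have /bigcupP[X XP iX] := AP _ (enum_valP i).
suff -> : row i (\matrix_(i, j) (adj (enum_val i) (enum_val j))%:R)%R
          = row (enum_rank_in XP X) N by exact: row_sub.
apply/rowP=> j; rewrite !mxE enum_rankK_in //; congr (_%:R)%R; congr nat_of_bool.
have tX := tP _ XP.
apply/idP/exists_inP => [h|[x xX]]; first by exists (enum_val i).
by rewrite (tX x (enum_val i)) // enum_valP.
Qed.

(** Neighbourhoods in [B] are supports of rows, and a row space of rank r over the field with two
    elements has 2^r vectors. *)
Lemma card_nbhd_leq A B :
  #|[set [set y in B | adj x y] | x in A]| <= 2 ^ cut_rank A B.
Proof.
rewrite /cut_rank; set M := (\matrix_(_, _) _)%R.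
(* [h] sends a coefficient vector over a row basis to the support of the combination; it is enough
   that [h] hits every neighbourhood. *)
pose h (u : 'rV['F_2]_(\rank M)) : {set G} :=
  [set enum_val j | j : 'I_#|B| & ((u *m row_base M) 0 j != 0)%R].
have : [set [set y in B | adj x y] | x in A] \subset h @: setT.
  apply/subsetP => _ /imsetP[x xA ->].
  have : (row (enum_rank_in xA x) M <= row_base M)%MS.
    by rewrite eq_row_base row_sub.
  case/submxP=> u hu; apply/imsetP; exists u; rewrite ?inE //.
  have hE j : ((u *m row_base M) 0 j != 0)%R = adj x (enum_val j).
    by rewrite -hu !mxE enum_rankK_in //; case: adj.
  apply/setP=> y; rewrite inE; apply/andP/imsetP => [[yB xy]|[j]].
    exists (enum_rank_in yB y); last by rewrite enum_rankK_in.
    by rewrite inE hE enum_rankK_in.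
  by rewrite inE hE => xj ->; rewrite enum_valP.
move/subset_leq_card/leq_trans; apply.
apply: leq_trans (leq_imset_card _ _) _.
by rewrite cardsT card_mx card_Fp // mul1n.
Qed.

End CutRank.

(** * Runs of merges *)

Section Runs.
Variable G : sgraph.
Implicit Types (A B X Y : {set G}) (P Q R : {set {set G}}).

(** A merge sequence without indices, with [Phi] holding at both ends and in between. It may live on
    a subset of the vertices, so that runs can be concatenated and extended by idle parts. *)
Inductive run (Phi : {set {set G}} -> Prop) :
    {set {set G}} -> {set {set G}} -> Prop :=
| run_refl P : Phi P -> run Phi P P
| run_step P P' Q : Phi P -> merge_of P P' -> run Phi P' Q -> run Phi P Q.

Lemma run_trans Phi P Q R : run Phi P Q -> run Phi Q R -> run Phi P R.
Proof. by elim=> // {}P P' {}Q hP m _ IH /IH; apply: run_step. Qed.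

Lemma run_impl Phi Psi P Q : (forall R, Phi R -> Psi R) -> run Phi P Q -> run Psi P Q.
Proof.
move=> imp; elim=> [R /imp|{}P P' {}Q /imp hP m _]; first exact: run_refl.
exact: run_step.
Qed.

Lemma run_end Phi P Q : run Phi P Q -> Phi Q.
Proof. by elim. Qed.

(** The parts of [R] stay idle: disjointness ensures that removing a merged pair never removes a
    part of [R]. *)
Lemma run_setU Phi Psi R P Q :
  (forall P, Phi P -> [disjoint P & R]) -> (forall P, Phi P -> Psi (P :|: R)) ->
  run Phi P Q -> run Psi (P :|: R) (Q :|: R).
Proof.
move=> dis imp; elim=> [{}P /imp|{}P P' {}Q hP [X [Y [XP YP XY P'E]]] _ IH].
  exact: run_refl.
apply: run_step IH; first exact: imp.
have notR Z : Z \in P -> Z \notin R by move=> ZP; rewrite (disjointFr (dis _ hP)).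
exists X, Y; rewrite !inE XP YP; split=> //; rewrite P'E -setUA; congr (_ |: _).
rewrite setDUl; congr (_ :|: _); apply/esym/setDidPl.
rewrite disjoint_sym; apply/pred0P=> Z /=; rewrite !inE.
by case: eqP => [->|_]; last case: eqP => [->|//]; rewrite (negbTE (notR _ _)).
Qed.

(** Each merge lowers the number of parts by exactly one, so the partitions of the run can be
    indexed by their number of parts. *)
Lemma run_partition_sequence Phi :
  0 < #|G| -> (forall P, Phi P -> partition P [set: G]) ->
  run Phi [set [set x] | x : G] [set [set: G]] ->
  exists2 F, partition_sequence F & forall i, 0 < i <= #|G| -> Phi (F i).
Proof.
move=> G0 part.
suff main P Q : run Phi P Q -> Q = [set [set: G]] -> 0 < #|P| /\ exists F,
    [/\ F #|P| = P, F 1 = [set [set: G]],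
        forall i, 0 < i <= #|P| -> Phi (F i)
      & forall i, 0 < i < #|P| -> merge_of (F i.+1) (F i)].
  move=> /main /(_ erefl)[_]; rewrite card_imset; last exact: set1_inj.
  by case=> F [F1 F2 F3 F4]; exists F => //; split=> // i /F3; apply: part.
elim=> [{}P hP PE|{}P P' {}Q hP m _ IH /IH {}IH].
  by rewrite PE cards1; split=> //; exists (fun=> P); split=> [//|//|//|]; lia.
have cP : #|P'|.+1 = #|P|.
  by case: m => X [Y [XP YP XY ->]]; case: (partition_merge (part _ hP) XP YP XY).
case: IH => P'0 [F [F1 F2 F3 F4]]; split; first by lia.
exists (fun i => if i == #|P| then P else F i); split.
- by rewrite eqxx.
- by rewrite ifN //; lia.
- by move=> i ilt; case: eqP => // iP; apply: F3; lia.
- move=> i ilt; have -> : (i == #|P|) = false by lia.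
  case: eqP => [iP|iP]; last by apply: F4; lia.
  have -> : i = #|P'| by lia.
  by rewrite F1.
Qed.

End Runs.

(** * Twin classes *)

Section Partitions.
Variable T : finType.
Implicit Types (A B X Y : {set T}) (P Q R : {set {set T}}).

Lemma partition_mergeU P A X Y : partition P A -> X \in P -> Y \in P -> X != Y ->
  let Q := (X :|: Y) |: (P :\: [set X; Y]) in
  partition Q A /\ #|Q| < #|P|.
Proof.
move=> pP XP YP XY Q.
have X0 := partition_neq0 pP XP.
have XYA : X :|: Y \subset A by rewrite subUset !(partitionS pP).
have QE : Q = (X :|: Y) |: (P :\ X :\ Y).
  by rewrite /Q setDDl.
have YPX : Y \in P :\ X by rewrite !inE eq_sym XY.
split; last first.
  rewrite QE cardsU1 (cardsD1 X P) XP (cardsD1 Y (P :\ X)) YPX.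
  by case: (_ \notin _).
rewrite QE -[A](setID _ (X :|: Y)) (setIidPr XYA).
apply: partitionU1.
- by rewrite -setDDl; apply: partitionD1 => //; apply: partitionD1.
- by rewrite setU_eq0 negb_and X0.
- by rewrite disjoint_sym disjoints_subset setDE subsetIr.
Qed.

Lemma partitionU P Q A B : partition P A -> partition Q B -> [disjoint A & B] ->
  partition (P :|: Q) (A :|: B).
Proof.
move=> pP pQ AB; apply/and3P; split.
- by rewrite /cover bigcup_setU -!/(cover _) (cover_partition pP) (cover_partition pQ).
- by apply: trivIsetU; rewrite ?(partition_trivIset pP) ?(partition_trivIset pQ) //
    (cover_partition pP) (cover_partition pQ).
- by rewrite inE (partition0 pP) (partition0 pQ).
Qed.

Lemma partition_disjoint P Q A B : partition P A -> partition Q B ->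
  [disjoint A & B] -> [disjoint P & Q].
Proof.
move=> pP pQ AB; apply/pred0P=> X /=; apply/negP=> /andP[XP XQ].
have /set0Pn[x xX] := partition_neq0 pP XP.
have xA := subsetP (partitionS pP XP) _ xX.
by have := subsetP (partitionS pQ XQ) _ xX; rewrite (disjointFr AB xA).
Qed.

Lemma partition_mem_eq P A X Y x :
  partition P A -> X \in P -> Y \in P -> x \in X -> x \in Y -> X = Y.
Proof.
move=> /partition_trivIset tP XP YP xX xY.
by rewrite -(def_pblock tP XP xX) -(def_pblock tP YP xY).
Qed.

Lemma partition_memP P A x : partition P A -> x \in A -> exists2 X, X \in P & x \in X.
Proof. by move=> pP; rewrite -(cover_partition pP) => /bigcupP[X]; exists X. Qed.

Definition singles A : {set {set T}} := [set [set x] | x in A].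

Lemma partition_singles A : partition (singles A) A.
Proof.
apply/and3P; split.
- apply/eqP/setP=> x; rewrite cover_imset; apply/bigcupP/idP => [[y yA]|xA].
    by rewrite inE => /eqP->.
  by exists x; rewrite ?inE.
- apply/trivIsetP=> _ _ /imsetP[x _ ->] /imsetP[y _ ->] xy.
  by rewrite disjoints1 inE; apply: contraNneq xy => ->.
- apply/imsetP=> -[x _ /esym/eqP]; apply/negP; apply/set0Pn.
  by exists x; rewrite inE.
Qed.

Lemma singlesU A B : singles (A :|: B) = singles A :|: singles B.
Proof. exact: imsetU. Qed.

Definition refines P Q := forall X, X \in P -> exists2 Y, Y \in Q & X \subset Y.

Lemma sub_partition_eq P Q A : partition P A -> partition Q A ->
  P \subset Q -> P = Q.
Proof.
move=> pP pQ PQ; apply/eqP; rewrite eqEsubset PQ; apply/subsetP=> Y YQ.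
have /set0Pn[x xY] := partition_neq0 pQ YQ.
have [X XP xX] := partition_memP pP (subsetP (partitionS pQ YQ) _ xY).
by rewrite (partition_mem_eq pQ YQ (subsetP PQ _ XP) xY xX).
Qed.

End Partitions.

Section TwinClasses.
Variable G : sgraph.
Implicit Types (A B X Y : {set G}) (P Q R : {set {set G}}).

(** As long as [P] differs from [Q], some part of [Q] contains two parts of [P]; merging them keeps
    a refinement of [Q]. *)
Lemma run_coarsen A P Q : partition P A -> partition Q A -> refines P Q ->
  run (fun R => [/\ partition R A, refines R Q & #|R| <= #|P|]) P Q.
Proof.
elim: {P}#|P| {-2}P (leqnn #|P|) => [|n IH] P Pn pP pQ PQ; last first.
  have [PQ'|/subsetPn[X XP XQ]] := boolP (P \subset Q).
    by move: PQ; rewrite -(sub_partition_eq pP pQ PQ') => PQ; apply: run_refl.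
  have [Z ZQ XZ] := PQ _ XP.
  (* A point of [Z] outside [X] yields the second part [Y], which lies in [Z] too because parts of
     [Q] are disjoint. *)
  have /properP[_ [x xZ xX]] : X \proper Z.
    by rewrite properEneq XZ andbT; apply: contraNneq XQ => ->.
  have [Y YP xY] := partition_memP pP (subsetP (partitionS pQ ZQ) _ xZ).
  have XY : X != Y by apply: contraNneq xX => ->.
  have [pR cR] := partition_mergeU pP XP YP XY.
  move: pR cR; set R := (X :|: Y) |: _ => pR cR.
  have RQ : refines R Q.
    move=> W; rewrite !inE => /orP[/eqP->|/andP[_ /PQ//]].
    exists Z; rewrite // subUset XZ.
    have [Z' Z'Q YZ'] := PQ _ YP.
    by rewrite (partition_mem_eq pQ ZQ Z'Q xZ (subsetP YZ' _ xY)).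
  apply: (@run_step _ _ _ R) => //; first by exists X, Y.
  have Rn : #|R| <= n by rewrite -ltnS (leq_trans cR).
  by apply: run_impl (IH _ Rn pR pQ RQ) => S [? ? /leq_trans SR]; split=> //; apply/SR/ltnW.
have P0 : P \subset Q by move: Pn; rewrite leqn0 cards_eq0 => /eqP->; apply: sub0set.
by move: PQ; rewrite -(sub_partition_eq pP pQ P0) => PQ; apply: run_refl.
Qed.

Definition twin_classes A := preim_partition (fun x => [set y in ~: A | adj x y]) A.

Lemma partition_twin_classes A : partition (twin_classes A) A.
Proof. exact: preim_partitionP. Qed.

Lemma twin_classesP A X : X \in twin_classes A -> twins_over (~: A) X.
Proof.
case/imsetP=> x _ -> y z; rewrite !inE => /andP[_ /eqP hy] /andP[_ /eqP hz] v vA.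
by have /setP/(_ v) := etrans (esym hy) hz; rewrite !inE; move: vA; rewrite inE => ->.
Qed.

Lemma twins_sub_class A X : X != set0 -> X \subset A -> twins_over (~: A) X ->
  exists2 Y, Y \in twin_classes A & X \subset Y.
Proof.
move=> /set0Pn[x xX] /subsetP XA tX.
exists [set y in A | [set z in ~: A | adj x z] == [set z in ~: A | adj y z]].
  by apply/imsetP; exists x; rewrite ?XA.
apply/subsetP=> y yX; rewrite inE XA //; apply/eqP/setP=> z; rewrite !inE.
by case: (boolP (z \in A)) => //= zA; apply: tX; rewrite // inE.
Qed.

Lemma card_twin_classes A : #|twin_classes A| <= 2 ^ cut_rank A (~: A).
Proof.
apply: leq_trans (card_nbhd_leq A (~: A)).
rewrite /twin_classes /preim_partition /equivalence_partition.
set f := fun x => [set y in ~: A | adj x y].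
rewrite (_ : imset _ _ = (fun c => [set y in A | c == f y]) @: (f @: A)).
  exact: leq_imset_card.
by rewrite -imset_comp.
Qed.

(* Parts satisfying [twins_over (~: A)] send no red edge out of A. *)
Definition good (Psi : {set {set G}} -> Prop) A R :=
  [/\ partition R A, {in R, forall X, twins_over (~: A) X} & Psi R].

Lemma good_singles (Psi : _ -> Prop) A : Psi (singles A) -> good Psi A (singles A).
Proof.
split=> //; first exact: partition_singles.
by move=> _ /imsetP[x _ ->]; apply: twins_over_set1.
Qed.

Lemma goodU (Phi Psi Om : _ -> Prop) A B R R' : [disjoint A & B] ->
  good Phi A R -> good Psi B R' -> Om (R :|: R') -> good Om (A :|: B) (R :|: R').
Proof.
move=> AB [pR tR _] [pR' tR' _] h; split=> //; first exact: partitionU.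
by move=> X; rewrite inE => /orP[/tR|/tR']; apply: twins_overS;
  rewrite setCU (subsetIl, subsetIr).
Qed.

(** [X] consists of twins over all that lies outside [A], hence over [Y], and symmetrically; a loop
    is excluded since [R] and [R'] share no part. *)
Lemma good_no_red (Phi Psi : _ -> Prop) A B R R' X Y : [disjoint A & B] ->
  good Phi A R -> good Psi B R' -> X \in R -> Y \in R' -> ~~ red (R :|: R') X Y.
Proof.
move=> AB [pR tR _] [pR' tR' _] XR YR'.
have XA := partitionS pR XR; have YB := partitionS pR' YR'.
have hXY : homogeneous X Y.
  apply: twins_homogeneous; [apply: twins_overS (tR _ XR)|apply: twins_overS (tR' _ YR')].
    by rewrite -disjoints_subset disjoint_sym; apply: disjointWr YB AB.
  by rewrite -disjoints_subset; apply: disjointWl XA AB.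
rewrite /red; case: eqP => [XY|_]; last by rewrite hXY !andbF.
have /pred0P/(_ X) := partition_disjoint pR pR' AB.
by rewrite /= XR XY YR'.
Qed.

Lemma red_setUl R R' X Y : X \in R -> Y \in R -> red (R :|: R') X Y = red R X Y.
Proof. by move=> XR YR; rewrite /red !inE XR YR. Qed.

(** Every refinement of the twin classes has parts made of twins, and merging only lowers the number
    of parts, so a bound on that number suffices for [Psi]. *)
Lemma run_good_coarsen (Psi : _ -> Prop) A R : partition R A ->
  refines R (twin_classes A) -> (forall R', #|R'| <= #|R| -> Psi R') ->
  run (good Psi A) R (twin_classes A).
Proof.
move=> pR rR h.
apply: run_impl (run_coarsen pR (partition_twin_classes A) rR) => S [pS rS /h hS].
split=> // X /rS[Y /twin_classesP tY /subsetP XY] x y /XY xX /XY yX.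
exact: tY.
Qed.

Lemma good_refines (Psi : _ -> Prop) A R : good Psi A R -> refines R (twin_classes A).
Proof.
case=> pR tR _ X XR; apply: twins_sub_class (tR _ XR).
  exact: partition_neq0 pR XR.
exact: partitionS pR XR.
Qed.

Lemma run_goodU (Psi : _ -> Prop) A B R P Q : [disjoint A & B] -> good Psi B R ->
  (forall R', good Psi A R' -> Psi (R' :|: R)) ->
  run (good Psi A) P Q -> run (good Psi (A :|: B)) (P :|: R) (Q :|: R).
Proof.
move=> AB gR h; apply: run_setU => S gS; last exact: goodU gS gR (h _ gS).
by case: gS gR => pS _ _ [pR _ _]; apply: partition_disjoint pS pR AB.
Qed.

(** No vertex lies outside the whole set, so nothing separates two vertices. Thus a run to the twin
    classes of the whole set ends in the one-part partition. *)
Lemma twin_classesT : 0 < #|G| -> twin_classes [set: G] = [set [set: G]].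
Proof.
move=> G0; have T0 : [set: G] != set0 by rewrite -card_gt0 cardsT.
apply/eqP; rewrite eqEsubset; apply/andP; split.
  apply/subsetP=> _ /imsetP[x _ ->]; rewrite inE; apply/eqP/setP=> y.
  by rewrite !inE; apply/eqP/setP=> z; rewrite !inE.
have tT : twins_over (~: [set: G]) [set: G] by move=> x y _ _ z; rewrite !inE.
have [Y YT] := twins_sub_class T0 (subxx _) tT.
by rewrite sub1set subTset => /eqP YE; rewrite YE in YT.
Qed.

End TwinClasses.

(** * Twin-width is bounded by rank-width *)

Section TwinWidthUpper.
Variable G : sgraph.
Implicit Types (A B X Y : {set G}) (P Q R : {set {set G}}).

(** Singletons carry no rank condition; their cut rank is at most 1, which is within [k] once
    [0 < k]. *)
Inductive branched (k : nat) : {set G} -> Prop :=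
| branched1 x : branched k [set x]
| branchedU A B : branched k A -> branched k B -> [disjoint A & B] ->
    cut_rank (A :|: B) (~: (A :|: B)) <= k -> branched k (A :|: B).

Inductive layered (k : nat) : {set G} -> Prop :=
| layered0 : layered k set0
| layeredU1 x A : layered k A -> x \notin A ->
    cut_rank (x |: A) (~: (x |: A)) <= k -> layered k (x |: A).

Definition comp_le w R := forall X, X \in R -> #|red_component R X| <= w.

Lemma comp_le_card w R : #|R| <= w -> comp_le w R.
Proof.
move=> Rw X _; apply: leq_trans Rw; apply/subset_leq_card/subsetP=> Y.
by rewrite inE => /andP[].
Qed.

(** By [good_no_red] a red walk starting in [R] never enters [R'], so the components of the union
    are components of one side. *)
Lemma comp_leU w A B R R' : [disjoint A & B] ->
  good (comp_le w) A R -> good (comp_le w) B R' -> comp_le w (R :|: R').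
Proof.
suff main (C D : {set G}) S S' : [disjoint C & D] -> good (comp_le w) C S ->
    good (comp_le w) D S' -> {in S, forall X, #|red_component (S :|: S') X| <= w}.
  move=> AB gR gR' X; rewrite inE => /orP[|]; first exact: main gR gR' X.
  by rewrite setUC; apply: main gR' gR X; rewrite disjoint_sym.
move: C D S S' => {}A {}B {}R {}R' AB gR gR' X XR;
case: (gR) => _ _ /(_ X XR); apply: leq_trans.
apply/subset_leq_card/subsetP=> Y; rewrite !inE => /andP[_ XY].
suff: Y \in R /\ connect (red R) X Y by case=> -> ->.
elim/connect_ind: XY => [|Y' Z _ [Y'R XY'] Y'Z]; first by rewrite connect0.
have ZR : Z \in R.
  have : Z \in R :|: R' by case/and3P: Y'Z.
  rewrite inE => /orP[//|ZR'].
  by move: Y'Z; rewrite (negbTE (good_no_red AB gR gR' Y'R ZR')).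
split=> //; apply: connect_trans XY' (connect1 _).
by rewrite red_setUl in Y'Z.
Qed.

Lemma card_classes_branched k A : branched k A -> #|twin_classes A| <= 2 ^ k.
Proof.
case=> [x|{}A B _ _ _ ck].
  by apply: leq_trans (leq_imset_card _ _) _; rewrite cards1 expn_gt0.
by apply: leq_trans (card_twin_classes _) _; rewrite leq_exp2l.
Qed.

Lemma card_classes_layered k A : layered k A -> #|twin_classes A| <= 2 ^ k.
Proof.
case=> [|x {}A _ _ ck].
  by apply: leq_trans (leq_imset_card _ _) _; rewrite cards0.
by apply: leq_trans (card_twin_classes _) _; rewrite leq_exp2l.
Qed.

(** At a union node, first contract [A] while [B] stays in singletons, then contract [B] beside the
    classes of [A], and last coarsen both to the classes of the union. Red edges between the two
    sides can appear only in the last phase. *)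
Lemma run_branched k A : branched k A ->
  run (good (comp_le (2 ^ k.+1)) A) (singles A) (twin_classes A).
Proof.
have small R : #|R| <= 1 -> comp_le (2 ^ k.+1) R.
  by move=> R1; apply/comp_le_card/(leq_trans R1); rewrite expn_gt0.
(* Singletons carry no loop and are pairwise homogeneous, so all red components have one part. *)
have good1 B : good (comp_le (2 ^ k.+1)) B (singles B).
  apply: good_singles => _ /imsetP[x xB ->].
  suff /subset_leq_card : red_component (singles B) [set x] \subset [set [set x]].
    by rewrite cards1 => /leq_trans; apply; rewrite expn_gt0.
  apply/subsetP=> Y; rewrite !inE => /andP[_].
  elim/connect_ind=> [//|Z W _ /eqP-> /and3P[_ /imsetP[y yB ->]]].
  case: eqP => [_|_]; first by rewrite cards1.
  by rewrite homogeneous_set1.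
elim=> {A} [x|A B bA IHA bB IHB AB cAB].
  apply: run_good_coarsen; first exact: partition_singles.
    exact: good_refines (good1 _).
  by move=> R'; rewrite /singles imset_set1 cards1; apply: small.
have gA := run_end IHA; have gB := run_end IHB.
have r1 : run (good (comp_le (2 ^ k.+1)) (A :|: B))
    (singles A :|: singles B) (twin_classes A :|: singles B).
  by apply: run_goodU IHA => // R' gR'; apply: comp_leU gR' (good1 B).
have r2 : run (good (comp_le (2 ^ k.+1)) (B :|: A))
    (singles B :|: twin_classes A) (twin_classes B :|: twin_classes A).
  have BA : [disjoint B & A] by rewrite disjoint_sym.
  by apply: run_goodU IHB => // R' gR'; apply: comp_leU gR' gA.
rewrite ![_ :|: twin_classes A]setUC [B :|: A]setUC in r2.
rewrite singlesU; apply: run_trans r1 (run_trans r2 _).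
(* From here on at most 2^k + 2^k parts remain, which bounds every component. *)
have gAB := run_end r2.
apply: run_good_coarsen; [by case: gAB|exact: good_refines gAB|] => R' R'le.
apply/comp_le_card/(leq_trans R'le)/(leq_trans (leq_card_setU _ _).1).
by rewrite expnS mul2n -addnn; apply: leq_add; apply: card_classes_branched.
Qed.

Lemma red_edges_leq R : #|red_edges R| <= #|R| ^ 2.
Proof.
rewrite -mulnn -cardsX.
apply: leq_trans (leq_imset_card (fun p => [set p.1; p.2]) _).
apply/subset_leq_card/subsetP=> _ /imset2P[X Y XR + ->].
by rewrite inE => /andP[YR _]; apply/imsetP; exists (X, Y); rewrite // inE XR.
Qed.

(** A red edge cannot cross, and singletons have neither loops nor red edges among themselves, so
    every red edge joins parts of [R]. *)
Lemma red_edges_singles A B R (Psi : _ -> Prop) : [disjoint A & B] -> good Psi A R ->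
  #|red_edges (R :|: singles B)| <= #|red_edges R|.
Proof.
move=> AB gR.
have gB : good (fun=> True) B (singles B) by apply: good_singles.
apply/subset_leq_card/subsetP=> _ /imset2P[X Y XR + ->]; rewrite inE => /andP[YR XY].
have notB Z W : Z \in singles B -> red (R :|: singles B) Z W -> False.
  move=> ZB ZW; have /and3P[_ + _] := ZW; rewrite inE => /orP[WR|WB].
    by move: ZW; rewrite red_sym (negbTE (good_no_red AB gR gB WR ZB)).
  case/imsetP: ZB ZW => x _ -> /and3P[_ _]; case/imsetP: WB => y _ ->.
  case: eqP => [_|_]; first by rewrite cards1.
  by rewrite homogeneous_set1.
have XR' : X \in R by move: XR; rewrite inE => /orP[//|/notB/(_ XY)].
have YR' : Y \in R.
  by move: YR; rewrite inE => /orP[//|/notB]; case/(_ X); rewrite red_sym.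
by apply/imset2P; exists X Y; rewrite // inE YR'; rewrite red_setUl in XY.
Qed.

(** The new vertex stays a singleton without red edges while [A] is contracted. Afterwards there are
    at most 2^k classes and this singleton, and red edges are at most the ordered pairs of parts. *)
Lemma run_layered k A : layered k A ->
  run (good (fun R => #|red_edges R| <= (2 ^ k).+1 ^ 2) A) (singles A) (twin_classes A).
Proof.
set Psi := fun R => _.
have small R : #|R| <= (2 ^ k).+1 -> Psi R.
  by move=> R1; apply: leq_trans (red_edges_leq R) _; rewrite leq_exp2r.
elim=> {A} [|x A lA IHA xA cxA].
  apply: run_good_coarsen; first exact: partition_singles.
    by move=> X; rewrite /singles imset0 inE.
  by move=> R'; rewrite /singles imset0 cards0 => R0; apply/small/(leq_trans R0).
have Ax : [disjoint A & [set x]] by rewrite disjoint_sym disjoints1.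
have gx : good Psi [set x] (singles [set x]).
  by apply: good_singles; rewrite /singles imset_set1; apply: small; rewrite cards1.
have r1 : run (good Psi (A :|: [set x]))
    (singles A :|: singles [set x]) (twin_classes A :|: singles [set x]).
  apply: run_goodU IHA => // R' gR'.
  by apply: leq_trans (red_edges_singles Ax gR') _; case: gR'.
have gAx := run_end r1.
rewrite setUC singlesU; apply: run_trans r1 _.
apply: run_good_coarsen; [by case: gAx|exact: good_refines gAx|] => R' R'le.
apply/small/(leq_trans R'le)/(leq_trans (leq_card_setU _ _).1).
rewrite /singles imset_set1 cards1 addn1 ltnS; exact: card_classes_layered lA.
Qed.


Lemma partition_sequence_run (Psi : _ -> Prop) : 0 < #|G| ->
  run (good Psi [set: G]) (singles [set: G]) (twin_classes [set: G]) ->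
  exists2 F, partition_sequence F & forall i, 0 < i <= #|G| -> Psi (F i).
Proof.
move=> G0; rewrite twin_classesT // /singles.
rewrite (_ : imset _ _ = [set [set x] | x : G]); last first.
  by apply/setP=> X; apply/imsetP/imsetP => -[x _ ->]; exists x; rewrite ?inE.
case/run_partition_sequence=> [//|P [] //|F pF gF].
by exists F => // i /gF[].
Qed.

Lemma ltww_leq_branched k : 0 < #|G| -> branched k [set: G] -> ltww G <= 2 ^ k.+1.
Proof.
move=> G0 /run_branched /(partition_sequence_run G0)[F pF hF].
have [_ minF] := nat_minP (ex_component_width G).
apply: leq_trans (minF (component_width F) _) _; first by exists F.
rewrite /component_width; apply/bigmax_leqP_seq => i + _.
by rewrite mem_index_iota => iG; apply/bigmax_leqP => X; apply: hF.
Qed.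

Lemma ttww_leq_layered k : 0 < #|G| -> layered k [set: G] -> ttww G <= (2 ^ k).+1 ^ 2.
Proof.
move=> G0 /run_layered /(partition_sequence_run G0)[F pF hF].
have [_ minF] := nat_minP (ex_total_width G).
apply: leq_trans (minF (total_width F) _) _; first by exists F.
rewrite /total_width; apply/bigmax_leqP_seq => i + _.
by rewrite mem_index_iota; apply: hF.
Qed.

End TwinWidthUpper.

(** * Rank-width is bounded by twin-width *)

Section RankWidthUpper.
Variable G : sgraph.
Implicit Types (A B X Y T W : {set G}) (P Q R S : {set {set G}}).

(** Such an [S] is a union of components of the red graph. *)
Definition red_closed P S :=
  S \subset P /\ forall X Y, X \in S -> red P X Y -> Y \in S.

(** A part outside [S] that is not homogeneous to a part of [S] would be joined to it in red, hence
    belong to [S]. So each part of [S] consists of twins over the complement. *)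
Lemma cut_rank_red_closed P S : partition P [set: G] -> red_closed P S ->
  cut_rank (cover S) (~: cover S) <= #|S|.
Proof.
move=> pP [/subsetP SP cS]; apply: cut_rank_leq_classes => // X XS x x' xX x'X y.
rewrite inE => yS; have [Y YP yY] := partition_memP pP (in_setT y).
have YS : Y \notin S by apply: contra yS => YS; apply/bigcupP; exists Y.
have hXY : homogeneous X Y.
  have XY : X != Y by apply: contraNneq YS => <-.
  apply: contraNT YS => hXY; apply: (cS X) => //.
  by rewrite /red (SP X) // YP (negbTE XY) hXY.
exact: (homogeneous_twins hXY).
Qed.

Lemma red_component_closed P X : X \in P -> red_closed P (red_component P X).
Proof.
move=> XP; split; first by apply/subsetP=> Y; rewrite inE => /andP[].
move=> Y Z; rewrite !inE => /andP[_ XY] YZ; apply/andP; split.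
  by case/and3P: YZ.
exact: connect_trans XY (connect1 YZ).
Qed.

Lemma coverD S S' : S' \subset S -> cover S = cover S' :|: cover (S :\: S').
Proof.
by move=> S'S; rewrite /cover -bigcup_setU setDE setUIr setUCr setIT (setUidPr S'S).
Qed.

Lemma cover_disjoint P S S' : partition P [set: G] -> S \subset P -> S' \subset P ->
  [disjoint S & S'] -> [disjoint cover S & cover S'].
Proof.
move=> pP /subsetP SP /subsetP S'P SS'; apply/pred0P=> x /=; apply/negP.
case/andP=> /bigcupP[X XS xX] /bigcupP[Y YS' xY].
have XY := partition_mem_eq pP (SP _ XS) (S'P _ YS') xX xY.
by move: YS'; rewrite -XY (disjointFr SS' XS).
Qed.

(** Split off one red component at a time: by symmetry of [red] the rest is again closed, and each
    union formed is covered by at most [k] parts. *)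
Lemma branched_red_closed k P S : partition P [set: G] ->
  (forall X, X \in P -> branched k (cover (red_component P X))) ->
  red_closed P S -> S != set0 -> #|S| <= k -> branched k (cover S).
Proof.
move=> pP bP; elim: {S}#|S| {-2}S (leqnn #|S|) => [|n IH] S Sn cS S0 Sk.
  by move: Sn; rewrite leqn0 cards_eq0 (negbTE S0).
have [SP clS] := cS; have /set0Pn[X XS] := S0.
have XP := subsetP SP _ XS.
have [CP clC] := red_component_closed XP.
have XC : X \in red_component P X by rewrite inE XP connect0.
have bC := bP X XP; move: bC CP clC XC; set C := red_component P X => bC CP clC XC.
have CS : C \subset S.
  apply/subsetP=> Y; rewrite inE => /andP[_]; elim/connect_ind=> // Z W _ ZS.
  exact: clS.
clearbody C.
have [SC0|SC0] := eqVneq (S :\: C) set0.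
  suff -> : S = C by []; apply/eqP; rewrite eqEsubset CS andbT.
  by rewrite -setD_eq0 SC0.
have cardSC : #|S :\: C| < #|S|.
  apply/proper_card/properP; split; first exact: subsetDl.
  by exists X; rewrite // in_setD XC.
rewrite (coverD CS); apply: branchedU => //.
- apply: IH => //; first by rewrite -ltnS (leq_trans cardSC).
    split; first by apply: subset_trans SP; apply: subsetDl.
    move=> Y Z; rewrite !inE => /andP[YC YS] YZ; rewrite (clS _ _ YS YZ) andbT.
    by apply: contra YC => ZC; apply: clC ZC _; rewrite red_sym.
  by apply: leq_trans Sk; apply: ltnW.
- apply: cover_disjoint pP _ _ _ => //.
    by apply: subset_trans SP; apply: subsetDl.
  by rewrite disjoint_sym disjoints_subset setDE subsetIr.
- by rewrite -coverD //; apply: leq_trans (cut_rank_red_closed pP cS) Sk.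
Qed.

Definition split_family P S := [set T in P | [exists W in S, T \subset W]].

Section Refinement.
Variables (P Q : {set {set G}}).
Hypotheses (pP : partition P [set: G]) (pQ : partition Q [set: G]).
Hypothesis PQ : refines P Q.

Lemma cover_split_family S : S \subset Q -> cover (split_family P S) = cover S.
Proof.
move=> /subsetP SQ; apply/setP=> x; apply/bigcupP/bigcupP=> -[T].
  rewrite inE => /andP[TP /exists_inP[W WS /subsetP TW]] xT.
  by exists W; rewrite ?TW.
move=> TS xT; have [W WP xW] := partition_memP pP (in_setT x).
exists W => //; rewrite inE WP; apply/exists_inP; exists T => //.
have [T' T'Q WT'] := PQ WP.
by rewrite (partition_mem_eq pQ (SQ _ TS) T'Q xT (subsetP WT' _ xW)).
Qed.

(** Homogeneity passes to subsets, so a red edge stays red after coarsening. If both ends fall into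
    one part [W], it becomes the loop at [W], which then has two vertices. *)
Lemma red_split T T' : red P T T' -> exists W W',
  [/\ W \in Q, W' \in Q, T \subset W, T' \subset W' & red Q W W'].
Proof.
case/and3P=> TP T'P TT'; have [W WQ TW] := PQ TP; have [W' W'Q T'W'] := PQ T'P.
have /set0Pn[x xT] := partition_neq0 pP TP.
have /set0Pn[x' x'T'] := partition_neq0 pP T'P.
exists W, W'; split=> //; rewrite /red WQ W'Q /=.
case: (W =P W') => [WW'|WW'].
  case: eqP TT' => [_ /leq_trans|TT' _]; first by apply; apply: subset_leq_card.
  apply/card_gt1P; exists x, x'; split; first exact: (subsetP TW).
    by rewrite WW'; apply: (subsetP T'W').
  by apply: contra_notN TT' => /eqP xx'; apply: (partition_mem_eq pP TP T'P xT); rewrite xx'.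
apply/negP=> /(homogeneousS TW T'W') hTT'; move: TT'; rewrite hTT'.
case: eqP => // TT'; case: WW'; apply: (partition_mem_eq pQ WQ W'Q (subsetP TW _ xT)).
by apply: (subsetP T'W'); rewrite -TT'.
Qed.

Lemma split_family_closed S : red_closed Q S -> red_closed P (split_family P S).
Proof.
case=> /subsetP SQ clS; split; first by apply/subsetP=> T; rewrite inE => /andP[].
move=> T T'; rewrite !inE => /andP[TP /exists_inP[W WS TW]] TT'.
have [W1 [W2 [W1Q W2Q TW1 T'W2 W12]]] := red_split TT'.
have /set0Pn[x xT] := partition_neq0 pP TP.
have W1E := partition_mem_eq pQ (SQ _ WS) W1Q (subsetP TW _ xT) (subsetP TW1 _ xT).
have /and3P[_ -> _] := TT'; apply/exists_inP; exists W2 => //.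
by apply: clS W12; rewrite -W1E.
Qed.

End Refinement.

Lemma merge_refines P Q : merge_of P Q -> refines P Q.
Proof.
case=> X [Y [XP YP XY ->]] T TP.
have [TXY|TXY] := boolP (T \in [set X; Y]); last first.
  by exists T; rewrite // !inE in TXY *; rewrite TXY TP orbT.
exists (X :|: Y); first by rewrite !inE eqxx.
by move: TXY; rewrite !inE => /orP[]/eqP->; rewrite ?subsetUl ?subsetUr.
Qed.

(** The only part of [Q] that is not a part of [P] is the merged one, and it splits in two. *)
Lemma card_split_family P Q S : partition P [set: G] -> partition Q [set: G] ->
  merge_of P Q -> S \subset Q -> #|split_family P S| <= #|S|.+1.
Proof.
move=> pP pQ [X [Y [XP YP XY QE]]] /subsetP SQ; pose Z := X :|: Y.
have ZQ : Z \in Q by rewrite QE !inE eqxx.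
have ZP : Z \notin P :\: [set X; Y].
  rewrite !inE; apply/negP=> /andP[+ ZP].
  have /set0Pn[x xX] := partition_neq0 pP XP.
  rewrite (partition_mem_eq pP ZP XP (x := x)) ?inE ?xX //.
  by rewrite eqxx.
have sub1 T : T \in split_family P S -> T \notin [set X; Y] -> T \in S :\ Z.
  rewrite inE => /andP[TP /exists_inP[W WS TW]] TXY.
  have /set0Pn[x xT] := partition_neq0 pP TP.
  have TD : T \in P :\: [set X; Y] by rewrite inE TXY.
  have TQ : T \in Q by rewrite QE in_setU1 TD orbT.
  rewrite in_setD1 [T in T \in S](partition_mem_eq pQ TQ (SQ _ WS) xT (subsetP TW _ xT)).
  by rewrite WS andbT; apply: contraNneq ZP => <-.
have sub2 T : T \in split_family P S -> T \in [set X; Y] -> Z \in S.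
  rewrite inE => /andP[TP /exists_inP[W WS TW]] TXY.
  have /set0Pn[x xT] := partition_neq0 pP TP.
  have xZ : x \in Z by move: TXY xT; rewrite !inE => /orP[]/eqP-> ->; rewrite ?orbT.
  by rewrite (partition_mem_eq pQ ZQ (SQ _ WS) xZ (subsetP TW _ xT)).
have [ZS|ZS] := boolP (Z \in S).
  have /subset_leq_card : split_family P S \subset [set X; Y] :|: (S :\ Z).
    apply/subsetP=> T TS; rewrite in_setU.
    by case: (boolP (T \in [set X; Y])) => //= /(sub1 _ TS).
  move/leq_trans; apply; apply: (leq_trans (leq_card_setU _ _).1).
  by rewrite cards2 XY (cardsD1 Z S) ZS.
apply: leqW; apply: subset_leq_card; apply/subsetP=> T TS.
have [/(sub2 _ TS)|/(sub1 _ TS)] := boolP (T \in [set X; Y]).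
  by rewrite (negbTE ZS).
by rewrite inE => /andP[].
Qed.

(** [Y] may equal [X]: a loop makes a part nonisolated, so isolated parts are singletons. *)
Definition nonisolated P := [set X in P | [exists Y, red P X Y]].

Lemma nonisolated_closed P : red_closed P (nonisolated P).
Proof.
split; first by apply/subsetP=> X; rewrite inE => /andP[].
move=> X Y _ XY; rewrite inE; have /and3P[_ -> _] := XY.
by apply/existsP; exists X; rewrite red_sym.
Qed.

Lemma card_nonisolated P : #|nonisolated P| <= 2 * #|red_edges P|.
Proof.
have /subset_leq_card/leq_trans : nonisolated P \subset cover (red_edges P).
  apply/subsetP=> X; rewrite inE => /andP[XP /existsP[Y XY]].
  apply/bigcupP; exists [set X; Y]; last by rewrite !inE eqxx.
  by have /and3P[_ YP _] := XY; apply/imset2P; exists X Y; rewrite // inE YP.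
apply; apply: leq_trans (leq_card_cover _).1 _; rewrite mulnC -sum_nat_const.
by apply: leq_sum => _ /imset2P[X Y _ _ ->]; rewrite cards2; case: eqP.
Qed.

(** The parts of [S'] outside [S] are isolated, hence single vertices that can be added one by one.
    Every family of parts containing all nonisolated ones is red-closed, so its number of parts
    bounds the cut rank. *)
Lemma layered_grow k P S S' : partition P [set: G] -> S \subset S' -> S' \subset P ->
  nonisolated P \subset S -> #|S'| <= k -> layered k (cover S) -> layered k (cover S').
Proof.
move=> pP + S'P + S'k.
elim: {S}#|S' :\: S| {-2}S (erefl #|S' :\: S|) => [|n IH] S cD SS' NS lS.
  have S'S : S' \subset S by rewrite -setD_eq0 -cards_eq0 cD.
  suff -> : S' = S by [].
  by apply/eqP; rewrite eqEsubset S'S.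
have /card_gt0P[X] : 0 < #|S' :\: S| by rewrite cD.
rewrite inE => /andP[XS XS'].
have XP := subsetP S'P _ XS'.
have isoX Y : ~~ red P X Y.
  apply: contra XS => XY; apply: (subsetP NS); rewrite inE XP.
  by apply/existsP; exists Y.
have /eqP/cards1P[x XE] : #|X| = 1.
  apply/eqP; rewrite eqn_leq card_gt0 (partition_neq0 pP XP) andbT leqNgt.
  by have := isoX X; rewrite /red XP eqxx.
have coverE : cover (X |: S) = x |: cover S.
  by rewrite /cover bigcup_setU big_set1 XE.
apply: (IH (X |: S)).
- apply/eqP; rewrite -eqSS -cD (cardsD1 X (S' :\: S)) inE XS XS' /= add1n.
  by rewrite setDDl [S :|: _]setUC.
- by rewrite subUset sub1set XS'.
- by apply: subset_trans NS _; apply: subsetUr.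
rewrite coverE; apply: layeredU1 => //.
  apply/negP=> /bigcupP[Y YS xY].
  have YP := subsetP S'P _ (subsetP SS' _ YS).
  have xX : x \in X by rewrite XE inE.
  by move: YS; rewrite -(partition_mem_eq pP XP YP xX xY) (negbTE XS).
have XSS' : X |: S \subset S' by rewrite subUset sub1set XS'.
rewrite -coverE; apply: leq_trans (leq_trans (subset_leq_card XSS') S'k).
apply: cut_rank_red_closed pP _; split; first exact: subset_trans XSS' S'P.
move=> Y Z _ YZ; rewrite inE; apply/orP; right; apply: (subsetP NS).
have /and3P[_ ZP _] := YZ; rewrite inE ZP.
by apply/existsP; exists Y; rewrite red_sym.
Qed.

(** Split back into parts of [P], the nonisolated parts of [Q] include those of [P], so
    [layered_grow] applies. The strict bound leaves room for the part gained by undoing the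
    merge. *)
Lemma layered_merge k P Q : partition P [set: G] -> partition Q [set: G] ->
  merge_of P Q -> 2 * #|red_edges Q| < k ->
  layered k (cover (nonisolated P)) -> layered k (cover (nonisolated Q)).
Proof.
move=> pP pQ PQ ck lP; have rPQ := merge_refines PQ.
have [NQ clQ] := nonisolated_closed Q.
rewrite -(cover_split_family pP pQ rPQ NQ).
apply: (layered_grow pP _ _ (subxx _)) lP.
- apply/subsetP=> X; rewrite inE => /andP[XP /existsP[Y XY]].
  have [W [W' [WQ W'Q XW YW' WW']]] := red_split pP pQ rPQ XY.
  rewrite inE XP; apply/exists_inP; exists W; rewrite // inE WQ.
  by apply/existsP; exists W'.
- by apply/subsetP=> X; rewrite inE => /andP[].
apply: leq_trans (card_split_family pP pQ PQ NQ) _.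
by apply: leq_ltn_trans ck; apply: card_nonisolated.
Qed.

(** Undoing the merge turns a red component of [Q] into a red-closed family of [P] with at most one
    more part, whence the strict bound. *)
Lemma branched_merge k P Q : partition P [set: G] -> partition Q [set: G] ->
  merge_of P Q -> (forall X, X \in Q -> #|red_component Q X| < k) ->
  (forall X, X \in P -> branched k (cover (red_component P X))) ->
  forall X, X \in Q -> branched k (cover (red_component Q X)).
Proof.
move=> pP pQ PQ ck bP X XQ; have rPQ := merge_refines PQ.
have clX := red_component_closed XQ; have [CQ _] := clX.
rewrite -(cover_split_family pP pQ rPQ CQ).
apply: (branched_red_closed pP bP).
- exact: (split_family_closed pP pQ).
- apply: contraTneq (partition_neq0 pQ XQ) => S0.
  have := cover_split_family pP pQ rPQ CQ; rewrite S0 /cover big_set0 => /setP E.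
  rewrite negbK -subset0; apply/subsetP=> x xX; rewrite E; apply/bigcupP.
  by exists X; rewrite // inE XQ connect0.
- by apply: leq_trans (card_split_family pP pQ PQ CQ) _; apply: ck.
Qed.

Lemma partition_sequence_ind (F : nat -> {set {set G}}) (Phi : _ -> Prop) :
  0 < #|G| -> partition_sequence F -> Phi [set [set x] | x : G] ->
  (forall i, 0 < i < #|G| -> partition (F i.+1) [set: G] -> partition (F i) [set: G] ->
    merge_of (F i.+1) (F i) -> Phi (F i.+1) -> Phi (F i)) -> Phi [set [set: G]].
Proof.
move=> G0 [pF sF eF mF] PhiS PhiI; rewrite -eF.
(* [j] counts the merges already made. *)
suff main j : j < #|G| -> Phi (F (#|G| - j)).
  by have := main #|G|.-1; rewrite (_ : #|G| - _ = 1); [apply|]; lia.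
elim: j => [|j IH] jG; first by rewrite subn0 sF.
have ij : (#|G| - j.+1).+1 = #|G| - j by lia.
apply: PhiI; rewrite ?ij; try lia; [apply: pF|apply: pF|rewrite -ij; apply: mF|apply: IH]; lia.
Qed.

Lemma red_singles X Y : red [set [set x] | x : G] X Y -> False.
Proof.
case/and3P=> /imsetP[x _ ->] /imsetP[y _ ->].
case: eqP => [_|_]; first by rewrite cards1.
by rewrite homogeneous_set1.
Qed.

(** Invariant along the sequence: every red component covers a branched set. It starts with
    one-vertex components and ends with the single part, which covers the graph. *)
Lemma branched_ltww : 0 < #|G| -> branched (ltww G).+1 [set: G].
Proof.
move=> G0; have [[F pF Fw] _] := nat_minP (ex_component_width G).
rewrite -/(ltww G) in Fw.
pose Phi P := forall X, X \in P -> branched (ltww G).+1 (cover (red_component P X)).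
have : Phi [set [set: G]].
  apply: (partition_sequence_ind G0 pF) => [_ /imsetP[x _ ->]|i iG p1 p0 m].
    rewrite (_ : red_component _ _ = [set [set x]]).
      by rewrite cover1; apply: branched1.
    apply/setP=> Y; rewrite !inE; apply/andP/eqP => [[_]|->].
      by elim/connect_ind=> // Z W _ _ /red_singles.
    by rewrite imset_f.
  apply: branched_merge => // X XF; rewrite ltnS -Fw /component_width.
  have iI : i \in index_iota 1 #|G|.+1 by rewrite mem_index_iota; lia.
  by apply: leq_trans (leq_bigmax_seq _ iI isT); apply: (leq_bigmax_cond _ XF).
move/(_ setT); rewrite inE eqxx => /(_ isT).
rewrite (_ : red_component _ _ = [set [set: G]]) ?cover1 //.
by apply/setP=> X; rewrite !inE andb_idr // => /eqP->; rewrite connect0.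
Qed.

(** Invariant: the nonisolated parts cover a layered set. The factor 2 counts the ends of a red
    edge, the successor the part gained by undoing a merge. *)
Lemma layered_ttww : 1 < #|G| -> layered (2 * ttww G).+1 [set: G].
Proof.
move=> G1; have [[F pF Fw] _] := nat_minP (ex_total_width G).
rewrite -/(ttww G) in Fw.
pose Phi P := layered (2 * ttww G).+1 (cover (nonisolated P)).
have : Phi [set [set: G]].
  apply: (partition_sequence_ind (ltnW G1) pF) => [|i iG p1 p0 m].
    rewrite /Phi (_ : nonisolated _ = set0) ?/cover ?big_set0; first exact: layered0.
    apply/setP=> X; rewrite !inE; apply/negP=> /andP[_ /existsP[Y]].
    exact: red_singles.
  apply: layered_merge => //; rewrite ltnS leq_mul2l -Fw /total_width.
  have iI : i \in index_iota 1 #|G|.+1 by rewrite mem_index_iota; lia.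
  exact: (leq_bigmax_seq _ iI isT).
(* With at least two vertices the last part carries a loop, so it is nonisolated. *)
rewrite /Phi (_ : nonisolated _ = [set [set: G]]) ?cover1 //.
apply/setP=> X; rewrite !inE andb_idr // => /eqP->; apply/existsP; exists setT.
by rewrite /red !inE !eqxx cardsT.
Qed.

End RankWidthUpper.

(** * Components of a tree minus an edge *)

Section TreeComponents.
Variables (N : finType) (t : rel N).
Hypothesis tT : is_tree t.
Implicit Types a b c x y : N.

Lemma set2_eq a b x y :
  ([set x; y] == [set a; b]) = (x == a) && (y == b) || (x == b) && (y == a).
Proof.
apply/eqP/orP => [E|[]/andP[/eqP-> /eqP->//]]; last by rewrite setUC.
have /set2P xE : x \in [set a; b] by rewrite -E set21.
have /set2P yE : y \in [set a; b] by rewrite -E set22.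
have /set2P aE : a \in [set x; y] by rewrite E set21.
have /set2P bE : b \in [set x; y] by rewrite E set22.
by case: xE => xE; case: yE => yE; case: aE => aE; case: bE => bE; subst;
  rewrite !eqxx; auto.
Qed.

Lemma del_edge_sym a b : symmetric (del_edge t a b).
Proof. by move=> x y; rewrite /del_edge (tree_sym tT) [[set x; y]]setUC. Qed.

Lemma del_edgeC a b : del_edge t a b =2 del_edge t b a.
Proof. by move=> x y; rewrite /del_edge [[set a; b]]setUC. Qed.

(** A simple path avoiding the edge has length at least 2, so the edge closes it to a cycle on at
    least three nodes. *)
Lemma del_edge_bridge a b : t a b -> ~~ connect (del_edge t a b) a b.
Proof.
move=> tab; apply/negP=> /connectP[p ap bE].
case/shortenP: ap bE => q aq uq _ bE; move: aq uq bE.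
case: q => [|c [|d q]] aq uq bE.
- by move: tab; rewrite bE (tree_irr tT).
- by move: bE aq => /= ->; rewrite /del_edge eqxx !andbF.
suff /(tree_acyclic tT) : ucycle t [:: a, c, d & q] by [].
rewrite /ucycle uq andbT (cycle_path a) /= -[last _ _]/(last a [:: c, d & q]) -bE.
rewrite (tree_sym tT) tab /=; by apply: (sub_path _ aq) => x y /andP[].
Qed.

Lemma del_edge_cover a b x : t a b ->
  connect (del_edge t a b) a x || connect (del_edge t b a) b x.
Proof.
move=> tab; rewrite [connect (del_edge t b a) b x](eq_connect (del_edgeC b a)).
have := tree_connected tT a x.
elim/connect_ind=> [|y z _ IH yz]; first by rewrite connect0.
have [|ne] := boolP ([set y; z] == [set a; b]).
  by rewrite set2_eq => /orP[]/andP[_ /eqP->]; rewrite connect0 ?orbT.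
have e1 : connect (del_edge t a b) y z by apply: connect1; rewrite /del_edge yz.
by case/orP: IH => /connect_trans/(_ e1) ->; rewrite ?orbT.
Qed.

Lemma del_edge_disjoint a b x : t a b ->
  connect (del_edge t a b) a x -> ~~ connect (del_edge t b a) b x.
Proof.
move=> tab ax; apply: contra (del_edge_bridge tab) => bx.
apply: connect_trans ax _.
by rewrite (sym_connect_sym (del_edge_sym a b)) (eq_connect (del_edgeC a b)).
Qed.

(** A walk from [c] avoiding the edge to [a] never meets [a], by [del_edge_bridge], so it cannot use
    the edge from [a] to [b]. *)
Lemma del_edge_step a b c x : t a b -> t a c -> c != b ->
  connect (del_edge t c a) c x -> connect (del_edge t a b) a x.
Proof.
move=> tab tac cb; have tca : t c a by rewrite (tree_sym tT).
elim/connect_ind=> [|y z cy ay yz].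
  apply: connect1; rewrite /del_edge tac set2_eq eqxx (negbTE cb) /=.
  by apply: contraTN tab => /andP[/eqP<- _]; rewrite (tree_irr tT).
apply: connect_trans ay (connect1 _); have /andP[tyz _] := yz.
have cz := connect_trans cy (connect1 yz).
rewrite /del_edge tyz; apply/negP; rewrite set2_eq => /orP[]/andP[/eqP E1 /eqP E2].
  by move/negP: (del_edge_bridge tca); apply; rewrite E1 in cy.
by move/negP: (del_edge_bridge tca); apply; rewrite E2 in cz.
Qed.

(** [c] is the node entered at the last departure from [a] on a walk to [x]. *)
Lemma del_edge_next a b x : t a b -> connect (del_edge t a b) a x -> x != a ->
  exists c, [/\ t a c, c != b & connect (del_edge t c a) c x].
Proof.
move=> tab ax xa;
suff [E|] : x = a \/ exists c, [/\ t a c, c != b & connect (del_edge t c a) c x].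
- by rewrite E eqxx in xa.
- by [].
elim/connect_ind: ax {xa} => [|y z _ IH /andP[yz ne]]; first by left.
have [ya|] := eqVneq y a.
  right; exists z; rewrite connect0; split=> //; first by rewrite -ya.
  by apply: contraNneq ne => ->; rewrite ya.
case: IH => [->|[c [tac cb cy]] ya]; first by rewrite eqxx.
have [E|ne'] := boolP ([set y; z] == [set c; a]).
  by move: E; rewrite set2_eq (negbTE ya) andFb orbF => /andP[_ /eqP->]; left.
right; exists c; split=> //; apply: connect_trans cy (connect1 _).
by rewrite /del_edge yz.
Qed.

Lemma del_edge_siblings a c d x : t a c -> t a d -> c != d ->
  connect (del_edge t c a) c x -> ~~ connect (del_edge t d a) d x.
Proof.
move=> tac tad cd cx; apply/negP=> /(del_edge_step tac tad).
rewrite eq_sym => /(_ cd) /(del_edge_disjoint tac).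
by rewrite cx.
Qed.

End TreeComponents.

Lemma cut_rank_setT (G : sgraph) : cut_rank [set: G] (~: [set: G]) = 0.
Proof.
apply/eqP; rewrite -leqn0 cut_rank_sym.
by apply: leq_trans (cut_rank_leq_card _ _) _; rewrite setCT cards0.
Qed.

(** * Vertex sets cut out by a branch decomposition *)

Section DecompositionSides.
Variables (G : sgraph) (D : branch_decomposition G).
Local Notation t := (tadj (b := D)).
Local Notation tT := (bd_tree D).
Implicit Types a b c d x : node D.

Lemma side_setC a b : t a b -> side b a = ~: side a b.
Proof.
move=> tab; apply/setP=> v; rewrite !inE.
have := del_edge_cover tT (leaf_of D v) tab.
have [/(del_edge_disjoint tT tab)/negbTE->//|_ /= ->//] := boolP (connect _ _ _).
Qed.

Lemma side_leaf a b : t a b -> leaf t a -> exists v, side a b = [set v].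
Proof.
move=> tab la; have [v vE] := (bd_leaves a).1 la; exists v.
apply/setP=> x; rewrite !inE; apply/idP/eqP => [ax|->]; last by rewrite vE connect0.
apply: (@bd_inj _ D); rewrite vE; apply/eqP; apply: contraT => xa.
have [c [tac cb _]] := del_edge_next tab ax xa.
by move/card_le1_eqP: la => /(_ b c); rewrite !inE => /(_ tab tac) E; rewrite E eqxx in cb.
Qed.

(** [c] and [d] are the other two neighbours of [a]. No vertex of the graph sits at the internal
    node [a], so each one on this side lies beyond [c] or beyond [d]. *)
Lemma side_internal a b : t a b -> internal t a -> exists c d,
  [/\ [set y | t a y] = [set b; c; d], c != d, b \notin [set c; d],
      side a b = side c a :|: side d a & [disjoint side c a & side d a]].
Proof.
move=> tab ia; have := bd_cubic ia; rewrite /degree (cardsD1 b) inE tab add1n => -[n2].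
have /cards2P[c [d [cd nE]]] : #|[set y | t a y] :\ b| == 2 by apply/eqP.
have aE : [set y | t a y] = [set b; c; d].
  by rewrite -setUA -nE setD1K // inE.
have bcd : b \notin [set c; d] by rewrite -nE !inE eqxx.
have tac : t a c by have : c \in [set y | t a y]; [rewrite aE !inE eqxx orbT|rewrite inE].
have tad : t a d by have : d \in [set y | t a y]; [rewrite aE !inE eqxx orbT|rewrite inE].
have /norP[cb db] : ~~ ((c == b) || (d == b)).
  by move: bcd; rewrite !inE ![b == _]eq_sym.
exists c, d; split=> //.
  apply/setP=> v; rewrite !inE; apply/idP/orP => [av|[]].
  - have va : leaf_of D v != a.
      by apply: contraNneq ia => <-; apply/bd_leaves; exists v.
    have [e [tae eb ev]] := del_edge_next tab av va.
    have : e \in [set y | t a y] by rewrite inE.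
    by rewrite aE !inE (negbTE eb) /= => /orP[]/eqP<-; auto.
  - exact: (del_edge_step tT).
  - exact: (del_edge_step tT).
apply/pred0P=> v /=; apply/negP=> /andP[]; rewrite !inE.
by move/(del_edge_siblings tT tac tad cd)/negP.
Qed.

Lemma del_edge_card a b c : t a b -> t a c -> c != b ->
  #|[set x | connect (del_edge t c a) c x]| < #|[set x | connect (del_edge t a b) a x]|.
Proof.
move=> tab tac cb; apply/proper_card/properP; split.
  by apply/subsetP=> x; rewrite !inE; apply: (del_edge_step tT).
exists a; rewrite !inE ?connect0 //.
by apply: (del_edge_bridge tT); rewrite (tree_sym tT).
Qed.

Lemma cut_rank_side a b : t a b -> cut_rank (side a b) (~: side a b) <= rank_width_of D.
Proof.
move=> tab; rewrite -(side_setC tab).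
exact: (@leq_bigmax_cond _ _ (fun e => cut_rank (side e.1 e.2) (side e.2 e.1)) (a, b)).
Qed.

(** Induction on the number of tree nodes on the side of [a], which drops on passing to a child
    since [a] itself is lost. *)
Lemma branched_side a b : t a b -> branched (rank_width_of D) (side a b).
Proof.
have [n] := ubnP #|[set x | connect (del_edge t a b) a x]|.
elim: n a b => // n IH a b an tab.
have [la|ia] := boolP (leaf t a).
  by have [v ->] := side_leaf tab la; apply: branched1.
have [c [d [aE cd bcd sE dis]]] := side_internal tab ia.
have nb e : e \in [set c; d] -> branched (rank_width_of D) (side e a).
  move=> ecd; have eb : e != b by apply: contraNneq bcd => <-.
  have tae : t a e.
    by have : e \in [set y | t a y]; [rewrite aE -setUA inE ecd orbT|rewrite inE].
  apply: IH; last by rewrite (tree_sym tT).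
  by apply: leq_trans (del_edge_card tab tae eb) _; rewrite -ltnS.
rewrite sE; apply: branchedU (nb _ (set21 _ _)) (nb _ (set22 _ _)) dis _.
by rewrite -sE cut_rank_side.
Qed.

Lemma side_setU a b : t a b -> side a b :|: side b a = [set: G].
Proof. by move=> tab; rewrite (side_setC tab) setUCr. Qed.

Lemma exists_edge : 1 < #|G| -> exists a b, t a b.
Proof.
case/card_gt1P=> u [v [_ _ uv]].
have /connectP[[|b p] /= ap vE] := tree_connected tT (leaf_of D u) (leaf_of D v).
  by rewrite (bd_inj vE) eqxx in uv.
by exists (leaf_of D u), b; case/andP: ap.
Qed.

(** Root the tree at the middle of an arbitrary edge. *)
Lemma branched_rank_width : 1 < #|G| -> branched (rank_width_of D) [set: G].
Proof.
case/exists_edge=> a [b tab]; rewrite -(side_setU tab).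
have tba : t b a by rewrite (tree_sym tT).
apply: branchedU (branched_side tab) (branched_side tba) _ _.
- by rewrite (side_setC tab) -setI_eq0 setICr.
- by rewrite side_setU // cut_rank_setT.
Qed.

Lemma layered_leaf a b : t a b -> leaf t a -> layered (rank_width_of D) (side a b).
Proof.
move=> tab la; have := cut_rank_side tab; have [v ->] := side_leaf tab la.
rewrite -(setU0 [set v]) => cv; apply: layeredU1 => //; first exact: layered0.
by rewrite inE.
Qed.

(** Sweep along the path of internal nodes: each one adds one hanging leaf to the set collected
    before, and the last one closes with a further leaf. *)
Lemma layered_linear : 1 < #|G| -> linear_decomposition D ->
  layered (rank_width_of D) [set: G].
Proof.
move=> G1 [p [up pI tp]]; have [a0 [b0 tab0]] := exists_edge G1.
have int_adj i y : i < size p -> t (nth a0 p i) y -> internal t y ->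
    exists2 j, j < size p & y = nth a0 p j /\ ((i.+1 == j) || (j.+1 == i)).
  move=> ip ty; rewrite -[internal t y]/(y \in internal t) -pI => yp.
  exists (index y p); first by rewrite index_mem.
  by rewrite nth_index // -(tp a0) ?index_mem // nth_index.
have intp i : i < size p -> internal t (nth a0 p i).
  by move=> ip; rewrite -[internal _ _]/(nth a0 p i \in internal t) -pI mem_nth.
have layeredU_leaf a b c d : t a b -> side a b = side c a :|: side d a ->
    [disjoint side c a & side d a] -> t d a -> leaf t d ->
    layered (rank_width_of D) (side c a) -> layered (rank_width_of D) (side a b).
  move=> tab sE dis tda ld lc; have := cut_rank_side tab.
  have [v vE] := side_leaf tda ld; rewrite sE vE setUC => cv.
  apply: layeredU1 => //; move: dis; rewrite vE disjoint_sym.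
  by rewrite disjoints1.
have nbrs a b c d e : [set y | t a y] = [set b; c; d] -> e \in [set c; d] -> t a e.
  by move=> aE ecd; have : e \in [set y | t a y]; [rewrite aE -setUA inE ecd orbT|rewrite inE].
(* [b] is the next path node if there is one; at the end of the path it is any neighbour. *)
have main i : forall b, i < size p -> t (nth a0 p i) b ->
    (i.+1 < size p -> nth a0 p i.+1 = b) -> layered (rank_width_of D) (side (nth a0 p i) b).
  elim/ltn_ind: i => i IH b ip; set a := nth a0 p i => tab pb.
  have [c [d [aE cd bcd sE dis]]] := side_internal tab (intp _ ip).
  have nb e : e \in [set c; d] -> internal t e -> exists2 j, j.+1 = i & e = nth a0 p j.
    move=> ecd ie; have [j jp [eE /orP[]/eqP ij]] :=
      int_adj i e ip (nbrs _ _ _ _ _ aE ecd) ie.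
      by move: bcd; rewrite -pb ij // -eE ecd.
    by exists j.
  have ld e : e \in [set c; d] -> layered (rank_width_of D) (side e a).
    move=> ecd; have tea : t e a by rewrite (tree_sym tT) (nbrs _ _ _ _ _ aE ecd).
    have [le|ie] := boolP (leaf t e); first exact: layered_leaf.
    have [j ij eE] := nb e ecd ie; rewrite eE; apply: IH; rewrite -?eE //; try lia.
    by rewrite ij.
  have [lfd|id] := boolP (leaf t d).
    apply: (layeredU_leaf a b c d) => //; last by apply: ld; rewrite set21.
    by rewrite (tree_sym tT) (nbrs _ _ _ _ _ aE (set22 _ _)).
  have [lfc|ic] := boolP (leaf t c).
    apply: (layeredU_leaf a b d c) => //; last by apply: ld; rewrite set22.
    - by rewrite setUC.
    - by rewrite disjoint_sym.
    - by rewrite (tree_sym tT) (nbrs _ _ _ _ _ aE (set21 _ _)).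
  (* An internal child can only be the preceding path node, so [c] and [d] are not both internal. *)
  have [j ij cE] := nb c (set21 _ _) ic; have [j' ij' dE] := nb d (set22 _ _) id.
  have jj' : j = j' by lia.
  by rewrite cE dE jj' eqxx in cd.
have final a b : t a b -> leaf t b -> layered (rank_width_of D) (side a b) ->
    layered (rank_width_of D) [set: G].
  move=> tab lb lab; have tba : t b a by rewrite (tree_sym tT).
  have [v vE] := side_leaf tba lb; have sC := side_setC tab.
  have TE : [set: G] = v |: side a b by rewrite -vE sC setUC setUCr.
  rewrite TE; apply: layeredU1 => //; last by rewrite -TE cut_rank_setT.
  by rewrite -in_setC -sC vE inE.
(* Without internal nodes the two ends of the chosen edge are both leaves. *)
have [p0|p0] := posnP (size p).
  have lf x : leaf t x.
    apply: contraT => ix; have : x \in p by rewrite pI.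
    by rewrite -index_mem p0 ltn0.
  by apply: final tab0 (lf b0) (layered_leaf tab0 (lf a0)).
have lastp : (size p).-1 < size p by lia.
(* The last path node has at most one internal neighbour, its predecessor, hence a leaf
   neighbour. *)
have [b tab lb] : exists2 b, t (nth a0 p (size p).-1) b & leaf t b.
  set a := nth _ _ _; have ia := intp _ lastp; rewrite -/a in ia.
  have [b tab] : exists b, t a b.
    have : 0 < degree t a by rewrite (bd_cubic ia).
    by case/card_gt0P=> b; rewrite inE; exists b.
  have [c [d [aE cd bcd sE dis]]] := side_internal tab ia.
  have tac := nbrs _ _ _ _ _ aE (set21 _ _); have tad := nbrs _ _ _ _ _ aE (set22 _ _).
  have [lc|ic] := boolP (leaf t c); first by exists c.
  have [ld|id] := boolP (leaf t d); first by exists d.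
  have [j jp [cE jl]] := int_adj _ c lastp tac ic.
  have [j' jp' [dE jl']] := int_adj _ d lastp tad id.
  have jj' : j = j' by lia.
  by rewrite cE dE jj' eqxx in cd.
by apply: final tab lb (main _ _ lastp tab _); lia.
Qed.

End DecompositionSides.

(** * Branch decompositions from laminar families *)

(** At a lowest node of a longer cycle both cycle neighbours are at least as high, so they would
    coincide. *)
Lemma acyclic_of_height (N : finType) (t : rel N) (h : N -> nat) : symmetric t ->
  (forall x y z, t x y -> t x z -> h x <= h y -> h x <= h z -> y = z) ->
  forall c, ucycle t c -> size c <= 2.
Proof.
move=> tsym hup c /andP[cyc uc]; rewrite leqNgt; apply/negP=> sc.
case: c cyc uc sc => // x0 c0; set c := x0 :: c0 => cyc uc sc.
have x0c : x0 \in c by rewrite inE eqxx.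
have [x xc xmin] := arg_minnP h x0c.
have [i s rs] := rot_to xc.
have us : uniq (x :: s) by rewrite -rs rot_uniq.
have ss : 2 < size (x :: s) by rewrite -rs size_rot.
have smin z : z \in x :: s -> h x <= h z by rewrite -rs mem_rot => /xmin.
move: cyc; rewrite -(rot_cycle i) rs; case: s {rs} us ss smin => // y s.
case/lastP: s => // s z us _ smin /= /andP[xy].
rewrite rcons_path last_rcons tsym => /andP[_ xz].
have yz : y = z.
  by apply: hup xy xz (smin _ _) (smin _ _); rewrite !inE ?mem_rcons ?inE eqxx ?orbT.
by case/and3P: us => _ + _; rewrite yz mem_rcons inE eqxx.
Qed.

Section Laminar.
Variable G : sgraph.
Implicit Types (A B X Y Z : {set G}) (F : {set {set G}}).

(** The vertex sets of a binary union tree, with the tree order recovered from inclusion; members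
    can then serve as nodes of a decomposition. *)
Record laminar_tree (k : nat) A F : Prop := {
  lam_sub : forall X, X \in F -> X \subset A;
  lam_top : A \in F;
  lam_neq0 : forall X, X \in F -> X != set0;
  lam_single : forall x, x \in A -> [set x] \in F;
  lam_split : forall X, X \in F -> 1 < #|X| -> exists Y Z,
    [/\ Y \in F, Z \in F, X = Y :|: Z & [disjoint Y & Z]];
  lam_lam : forall X Y, X \in F -> Y \in F ->
    [\/ X \subset Y, Y \subset X | [disjoint X & Y]];
  lam_cut : forall X, X \in F -> cut_rank X (~: X) <= k }.

Lemma laminar_set1 k x : 0 < k -> laminar_tree k [set x] [set [set x]].
Proof.
move=> k0; split=> [X|||y|X|X Y|X]; rewrite ?inE.
- by move=> /eqP->.
- by [].
- by move=> X; rewrite inE => /eqP->; apply/set0Pn; exists x; rewrite inE.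
- by move=> /eqP->.
- by move=> /eqP->; rewrite cards1.
- by move=> /eqP-> /eqP->; constructor 1.
- by move=> /eqP->; apply: leq_trans (cut_rank_leq_card _ _) _; rewrite cards1.
Qed.

Lemma laminar_setU k A B F F' : laminar_tree k A F -> laminar_tree k B F' ->
  [disjoint A & B] -> cut_rank (A :|: B) (~: (A :|: B)) <= k ->
  laminar_tree k (A :|: B) ((A :|: B) |: (F :|: F')).
Proof.
move=> lF lF' AB ck.
have sub X : X \in (A :|: B) |: (F :|: F') -> X \subset A :|: B.
  rewrite !inE => /or3P[/eqP->//|/(lam_sub lF)|/(lam_sub lF')] XA;
  by apply: subset_trans XA _; rewrite ?subsetUl ?subsetUr.
have dis X Y : X \in F -> Y \in F' -> [disjoint X & Y].
  by move=> XF YF'; apply: disjointW AB; [apply: (lam_sub lF)|apply: (lam_sub lF')].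
split=> //.
- by rewrite !inE eqxx.
- move=> X; rewrite !inE => /or3P[/eqP->|/(lam_neq0 lF)//|/(lam_neq0 lF')//].
  by rewrite setU_eq0 negb_and (lam_neq0 lF) // (lam_top lF).
- move=> x; rewrite !inE => /orP[/(lam_single lF)->|/(lam_single lF')->];
  by rewrite ?orbT.
- move=> X; rewrite !inE => /or3P[/eqP->|XF|XF'] X1.
  + by exists A, B; rewrite !inE (lam_top lF) (lam_top lF') !orbT.
  + by have [Y [Z [YF ZF XE YZ]]] := lam_split lF XF X1;
    exists Y, Z; rewrite !inE YF ZF !orbT.
  + by have [Y [Z [YF ZF XE YZ]]] := lam_split lF' XF' X1;
    exists Y, Z; rewrite !inE YF ZF !orbT.
- move=> X Y XFF YFF; have := sub _ XFF; have := sub _ YFF; move: XFF YFF.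
  rewrite !inE => /or3P[/eqP->|XF|XF'] /or3P[/eqP->|YF|YF'] sY sX;
    try by [constructor 1|constructor 2].
  + exact: (lam_lam lF).
  + by constructor 3; apply: dis.
  + by constructor 3; rewrite disjoint_sym; apply: dis.
  + exact: (lam_lam lF').
- by move=> X; rewrite !inE => /or3P[/eqP->//|/(lam_cut lF)|/(lam_cut lF')].
Qed.

Lemma branched_laminar k A : 0 < k -> branched k A -> exists F, laminar_tree k A F.
Proof.
move=> k0; elim=> [x|{}A B _ [F lF] _ [F' lF'] AB ck].
  by exists [set [set x]]; apply: laminar_set1.
by exists ((A :|: B) |: (F :|: F')); apply: laminar_setU.
Qed.

(** Each new set contains all earlier ones and otherwise only a singleton is added, so the larger
    members form a chain: the future path of internal nodes. *)
Lemma layered_laminar k A : 0 < k -> layered k A -> A != set0 ->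
  exists2 F, laminar_tree k A F & forall X Y, X \in F -> Y \in F ->
    1 < #|X| -> 1 < #|Y| -> X \subset Y \/ Y \subset X.
Proof.
move=> k0; elim=> [|x {}A lA IH xA ck _]; first by rewrite eqxx.
have lx := laminar_set1 x k0.
have [A0|/IH[F lF cF]] := eqVneq A set0.
  rewrite A0 setU0; exists [set [set x]] => // X Y.
  by rewrite !inE => /eqP-> /eqP->; left.
have dis : [disjoint [set x] & A] by rewrite disjoints1.
have lxA := laminar_setU lx lF dis ck.
exists ((x |: A) |: ([set [set x]] :|: F)) => // X Y.
move=> XF YF; have := lam_sub lxA XF; have := lam_sub lxA YF; move: XF YF.
rewrite !inE => /or3P[/eqP->|/eqP->|XF] /or3P[/eqP->|/eqP->|YF] sX sY;
  rewrite ?cards1 //; auto.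
Qed.

Variables (k : nat) (F : {set {set G}}).
Hypotheses (lF : laminar_tree k [set: G] F) (G1 : 1 < #|G|).

Let nontop X := (X \in F) && (X != [set: G]).

Lemma sub_split X Y Z : X \in F -> Y \in F -> Z \in F -> X \subset Y :|: Z ->
  [\/ X = Y :|: Z, X \subset Y | X \subset Z].
Proof.
move=> XF YF ZF XYZ.
have onlyL U V : X \subset U :|: V -> [disjoint X & V] -> X \subset U.
  move=> XUV XV; rewrite -(setIidPl XUV) setIUr; move: XV; rewrite -setI_eq0 => /eqP->.
  by rewrite setU0 subsetIr.
case: (lam_lam lF XF YF) => [|YX|XY]; [by constructor 2| |].
  case: (lam_lam lF XF ZF) => [|ZX|XZ]; first by constructor 3.
    by constructor 1; apply/eqP; rewrite eqEsubset XYZ subUset YX ZX.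
  by constructor 2; apply: onlyL XZ.
by constructor 3; apply: onlyL XY; rewrite setUC.
Qed.

Lemma disjoint_neq0 X Y : [disjoint X & Y] -> X != set0 -> ~~ (X \subset Y).
Proof.
move=> XY; apply: contra => /setIidPl <-; by rewrite setI_eq0.
Qed.

(** The default [[set: G]] is a valid candidate for every [X] other than the whole set. Laminarity
    makes the smallest candidate least for inclusion. *)
Definition parent X := [arg min_(Y < [set: G] | (Y \in F) && (X \proper Y)) #|Y|].

Lemma parentP X : nontop X -> [/\ parent X \in F, X \proper parent X
  & forall Y, Y \in F -> X \proper Y -> parent X \subset Y].
Proof.
case/andP=> XF XT; rewrite /parent.
case: arg_minnP => [|P /andP[PF XP] Pmin]; first by rewrite (lam_top lF) properT.
split=> // Y YF XY; have := Pmin Y; rewrite YF XY => /(_ isT) cPY.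
case: (lam_lam lF PF YF) => [//|YP|PY].
  by have /eqP-> : Y == P by rewrite eqEcard YP.
case/negP: (disjoint_neq0 (disjointWl (proper_sub XP) PY) (lam_neq0 lF XF)).
exact: proper_sub.
Qed.

Lemma parent_child P Y Z : Y \in F -> Z \in F -> P = Y :|: Z ->
  [disjoint Y & Z] -> P \in F -> nontop Y /\ parent Y = P.
Proof.
move=> YF ZF PE YZ PF.
have YP : Y \proper P.
  rewrite properE PE subsetUl subUset subxx /=; apply: disjoint_neq0 (lam_neq0 lF ZF).
  by rewrite disjoint_sym.
have ntY : nontop Y by rewrite /nontop YF -properT; apply: proper_sub_trans YP (subsetT _).
split=> //; have [pF Yp /(_ _ PF YP)] := parentP ntY.
rewrite {1}PE => /(sub_split pF YF ZF)[->//|pY|pZ].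
  by move: Yp; rewrite properE pY andbF.
case/negP: (disjoint_neq0 YZ (lam_neq0 lF YF)).
exact: subset_trans (proper_sub Yp) pZ.
Qed.

(** By [sub_split], [X] lies in [Y] or in [Z]; a proper inclusion would give a superset of [X] in
    the family that does not contain [P]. *)
Lemma parent_split X P Y Z : nontop X -> parent X = P -> Y \in F -> Z \in F ->
  P = Y :|: Z -> [disjoint Y & Z] -> X = Y \/ X = Z.
Proof.
move=> ntX XP YF ZF PE YZ; have [PF XpP Pmin] := parentP ntX.
rewrite XP in PF XpP Pmin; have /andP[XF _] := ntX.
have ZY : [disjoint Z & Y] by rewrite disjoint_sym.
have no U V : U \in F -> V \in F -> P = U :|: V -> [disjoint V & U] -> X \subset U -> X = U.
  move=> UF VF PUV VU XU; apply/eqP; apply: contraT => XneU.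
  have XpU : X \proper U by rewrite properEneq XneU.
  have := Pmin _ UF XpU; rewrite PUV subUset => /andP[_ VsU].
  by case/negP: (disjoint_neq0 VU (lam_neq0 lF VF)).
have := proper_sub XpP; rewrite PE => /(sub_split XF YF ZF)[XE|XY|XZ].
- by move: XpP; rewrite PE XE properxx.
- by left; apply: (no Y Z).
- by right; apply: (no Z Y); rewrite // setUC.
Qed.

Lemma top_split : exists Y Z,
  [/\ Y \in F, Z \in F, [set: G] = Y :|: Z, [disjoint Y & Z] & ~: Y = Z].
Proof.
have T1 : 1 < #|[set: G]| by rewrite cardsT.
have [Y [Z [YF ZF TE YZ]]] := lam_split lF (lam_top lF) T1.
exists Y, Z; split=> //; apply/setP=> x; have := in_setT x; rewrite TE !inE.
by case: (boolP (x \in Y)) => [xY _|_ /= ->//]; rewrite (disjointFr YZ xY).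
Qed.

(* The root [set: G] is suppressed: its two children become adjacent. *)
Definition up X := if parent X == [set: G] then ~: X else parent X.

Lemma upP X : nontop X -> nontop (up X) /\
  (X \proper up X /\ up X = parent X \/
   [/\ up X = ~: X, parent X = setT & up (~: X) = X]).
Proof.
move=> ntX; rewrite /up; case: eqP => [pT|/eqP pT]; last first.
  have [pF Xp _] := parentP ntX; split; first by rewrite /nontop pF.
  by left.
have [Y [Z [YF ZF TE YZ YC]]] := top_split.
have ZY : [disjoint Z & Y] by rewrite disjoint_sym.
have ZC : ~: Z = Y by rewrite -YC setCK.
have [ntY pY] := parent_child YF ZF TE YZ (lam_top lF).
have TE' : setT = Z :|: Y by rewrite setUC.
have [ntZ pZ] := parent_child ZF YF TE' ZY (lam_top lF).
have [XE|XE] := parent_split ntX pT YF ZF TE YZ; rewrite XE ?YC ?ZC.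
  by split=> //; right; rewrite pZ eqxx.
by split=> //; right; rewrite pY eqxx.
Qed.

Definition up_adj X Y := (Y == up X) || (X == up Y).

(** Each node thus has only one neighbour of at least its size. In the case [X = up Y] sizes force
    the edge between the two halves, where [up] is an involution. *)
Lemma up_adjP X Y : nontop X -> nontop Y -> up_adj X Y -> #|X| <= #|Y| -> Y = up X.
Proof.
move=> ntX ntY /orP[/eqP//|/eqP XE] cXY.
have [_ [[Yp _]|[uY _ uC]]] := upP ntY; last by rewrite XE uY uC.
by move: (proper_card Yp); rewrite -XE ltnNge cXY.
Qed.

Lemma up_neq X : nontop X -> up X != X.
Proof.
move=> ntX; have [_ [[+ _]|[-> _ _]]] := upP ntX.
  by rewrite properEneq eq_sym => /andP[].
have /andP[/(lam_neq0 lF)/set0Pn[x xX] _] := ntX.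
by apply/negP=> /eqP/setP/(_ x); rewrite !inE xX.
Qed.

Lemma up_adj_sym : symmetric up_adj.
Proof. by move=> X Y; rewrite /up_adj orbC. Qed.

Definition lnode : finType := {X : {set G} | nontop X}.
Definition ladj (x y : lnode) := up_adj (val x) (val y).

Lemma lnodeP X : nontop X -> exists x : lnode, val x = X.
Proof. by move=> ntX; exists (Sub X ntX). Qed.

Lemma ladj_tree : is_tree ladj.
Proof.
have ls : symmetric ladj by move=> x y; apply: up_adj_sym.
have cs := sym_connect_sym ls.
split=> //.
- move=> x; apply/negP; rewrite /ladj /up_adj orbb eq_sym.
  by rewrite (negbTE (up_neq (valP x))).
(* Climbing by [up] strictly enlarges the set until a half of the whole set is reached; the two
   halves are equal or adjacent. *)
- have root (x : lnode) : exists2 y, connect ladj x y & parent (val y) = setT.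
    have [n] := ubnP (#|G| - #|val x|); elim: n x => // n IH x xn.
    have [nt [[xp pE]|[_ pT _]]] := upP (valP x); last by exists x.
    have [y yE] := lnodeP nt.
    have [|z yz pz] := IH y.
      have c1 := proper_card xp; have c2 : #|up (val x)| <= #|G| := max_card _.
      by rewrite yE; move: c1 c2 xn; move: #|_| #|_| #|_|; lia.
    exists z => //; apply: connect_trans (connect1 _) yz.
    by rewrite /ladj /up_adj yE eqxx.
  move=> x y; have [x' xx' px] := root x; have [y' yy' py] := root y.
  apply: connect_trans xx' _; rewrite cs; apply: connect_trans yy' _.
  have [->//|ne] := eqVneq y' x'; apply: connect1; rewrite /ladj /up_adj.
  have [Y [Z [YF ZF TE YZ YC]]] := top_split.
  rewrite /up px py eqxx.
  have [xE|xE] := parent_split (valP x') px YF ZF TE YZ;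
  have [yE|yE] := parent_split (valP y') py YF ZF TE YZ.
  + by case/eqP: ne; apply: val_inj; rewrite yE xE.
  + by rewrite yE xE YC eqxx orbT.
  + by rewrite yE xE YC eqxx.
  + by case/eqP: ne; apply: val_inj; rewrite yE xE.
- apply: (acyclic_of_height (h := fun x : lnode => #|val x|)) => // x y z xy xz cy cz.
  apply: val_inj.
  exact: etrans (up_adjP (valP x) (valP y) xy cy) (esym (up_adjP (valP x) (valP z) xz cz)).
Qed.

Lemma ladj_leaf (x : lnode) : #|val x| <= 1 -> leaf ladj x.
Proof.
move=> x1; suff up1 y : ladj x y -> val y = up (val x).
  by apply/card_le1_eqP => y z; rewrite !inE => /up1 yE /up1 zE; apply: val_inj; rewrite yE zE.
move=> xy; apply: (up_adjP (valP x) (valP y) xy); apply: leq_trans x1 _.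
by rewrite card_gt0; apply: (lam_neq0 lF); case/andP: (valP y).
Qed.

(** The neighbours are [up] of the set and the two sets into which it splits. *)
Lemma ladj_degree (x : lnode) : 1 < #|val x| -> degree ladj x = 3.
Proof.
move=> x1; have ntX := valP x; have /andP[XF XT] := ntX.
have [Y [Z [YF ZF XE YZ]]] := lam_split lF XF x1.
have ZY : [disjoint Z & Y] by rewrite disjoint_sym.
have [ntY pY] := parent_child YF ZF XE YZ XF.
have XE' : val x = Z :|: Y by rewrite setUC.
have [ntZ pZ] := parent_child ZF YF XE' ZY XF.
have uY : up Y = val x by rewrite /up pY (negbTE XT).
have uZ : up Z = val x by rewrite /up pZ (negbTE XT).
have [ntU uX] := upP ntX.
have nU W : W \in F -> W \subset val x -> W != val x -> W != up (val x).
  move=> WF WX WneX; apply: contraTneq WX => WE.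
  case: uX => [[Xp _]|[uE _ _]]; first by rewrite WE; case/andP: Xp.
  by apply: disjoint_neq0 (lam_neq0 lF WF); rewrite WE uE -setI_eq0 setIC setICr.
have YX : Y \subset val x by rewrite XE subsetUl.
have ZX : Z \subset val x by rewrite XE subsetUr.
have YneX : Y != val x by rewrite -uY eq_sym up_neq.
have ZneX : Z != val x by rewrite -uZ eq_sym up_neq.
have YneZ : Y != Z by apply: contraTneq YZ => <-; rewrite -setI_eq0 setIid (lam_neq0 lF).
rewrite /degree -(card_imset _ val_inj).
rewrite (_ : imset _ _ = up (val x) |: [set Y; Z]).
  by rewrite cardsU1 cards2 YneZ !inE negb_or ![up _ == _]eq_sym !nU.
apply/setP=> W; apply/imsetP/setU1P => [[y]|].
  rewrite inE => /orP[/eqP yE ->|/eqP xE ->]; first by left.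
  have [_ [[_ uE]|[uE _ uC]]] := upP (valP y); last by left; rewrite xE uE uC.
  right; apply/set2P; apply: (parent_split (valP y) _ YF ZF XE YZ).
  by rewrite -uE xE.
have mk V : nontop V -> up_adj (val x) V -> exists2 y, y \in [set y | ladj x y] & V = val y.
  by move=> /lnodeP[y <-] xV; exists y; rewrite // inE.
case=> [->|/set2P[]->]; apply: mk => //; rewrite /up_adj ?uY ?uZ eqxx ?orbT //.
Qed.

Lemma ladj_leafE (x : lnode) : leaf ladj x = (#|val x| <= 1).
Proof.
by case: leqP => [/ladj_leaf//|/ladj_degree]; rewrite /leaf => ->.
Qed.

Lemma nontop_set1 v : nontop [set v].
Proof.
rewrite /nontop (lam_single lF) ?inE //=; apply: contraTneq G1 => E.
by rewrite -cardsT -E cards1.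
Qed.

Definition lleaf (v : G) : lnode := Sub [set v] (nontop_set1 v).

Definition laminar_decomposition : branch_decomposition G.
Proof.
refine (@BranchDecomposition G lnode ladj lleaf ladj_tree _ _ _).
- by move=> x; rewrite /internal ladj_leafE -ltnNge; apply: ladj_degree.
- by move=> u v /(congr1 val) /set1_inj.
- move=> x; rewrite ladj_leafE; split=> [x1|[v <-]]; last by rewrite /= cards1.
  have /cards1P[v vE] : #|val x| == 1.
    by rewrite eqn_leq x1 card_gt0; apply: (lam_neq0 lF); case/andP: (valP x).
  by exists v; apply: val_inj.
Defined.

(** The component of [x] consists of the members contained in it: only the deleted edge leaves them,
    and climbing by parents joins each of them to [x]. *)
Lemma side_laminar (x y : lnode) : val y = up (val x) ->
  side (D := laminar_decomposition) x y = val x.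
Proof.
move=> yE; have ntX := valP x; have [_ uX] := upP ntX; have /andP[XF XT] := ntX.
have up_in (z : lnode) : val z \proper val x ->
    parent (val z) \subset val x /\ up (val z) = parent (val z).
  move=> zx; have [_ _ /(_ _ XF zx) px] := parentP (valP z).
  split=> //; rewrite /up; case: eqP => // pT.
  by move: px; rewrite pT subTset (negbTE XT).
apply/setP=> v; rewrite inE; apply/idP/idP => [|vx].
  suff main (z : lnode) : connect (del_edge ladj x y) x z -> val z \subset val x.
    by move/main; rewrite sub1set.
  elim/connect_ind=> // {}z w _ zx /andP[zw ne].
  have notx : z = x -> val w = up (val z) -> False.
    move=> E wE; case/negP: ne; rewrite E (_ : w = y) //.
    by apply: val_inj; rewrite wE E yE.
  have [E|zneX] := eqVneq (val z) (val x).
    have zE : z = x by apply: val_inj.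
    case/orP: zw => /eqP wE; first by case: (notx zE wE).
    have [_ [[wp _]|[uW _ uC]]] := upP (valP w).
      by rewrite -E wE; apply: proper_sub.
    by case: (notx zE); rewrite wE uW uC.
  have zpx : val z \proper val x by rewrite properEneq zneX.
  have [pzx uz] := up_in z zpx.
  case/orP: zw => /eqP wE; first by rewrite wE uz.
  have [_ [[wp _]|[uW _ uC]]] := upP (valP w).
    by apply: subset_trans (proper_sub wp) _; rewrite -wE.
  have : up (val z) = val w by rewrite wE uW uC.
  by rewrite uz => <-.
have sym := sym_connect_sym (del_edge_sym ladj_tree x y).
suff main (z : lnode) : val z \subset val x -> connect (del_edge ladj x y) z x.
  by rewrite sym; apply: main; rewrite /= sub1set.
have [n] := ubnP (#|val x| - #|val z|); elim: n z => // n IH z zn zx.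
have [E|zneX] := eqVneq (val z) (val x).
  by rewrite (_ : z = x) //; apply: val_inj.
have zpx : val z \proper val x by rewrite properEneq zneX.
have [pzx uz] := up_in z zpx.
have [ntu _] := upP (valP z); have [w wE] := lnodeP ntu.
have [_ zpz _] := parentP (valP z).
have wx : val w \subset val x by rewrite wE uz.
apply: connect_trans (connect1 _) (IH w _ wx); last first.
  have c1 := proper_card zpz; have c2 := subset_leq_card wx.
  have c3 : #|val w| = #|parent (val z)| by rewrite wE uz.
  by move: c1 c2 c3 zn; move: #|_| #|_| #|_| #|_|; lia.
rewrite /del_edge /ladj /up_adj wE eqxx /=; apply: contra zneX.
rewrite set2_eq => /orP[/andP[/eqP->//]|/andP[/eqP zE _]].
move: zx; rewrite zE yE; case: uX => [[xp _]|[uE _ _]].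
  by move=> ux; move: xp; rewrite properE ux andbF.
have y0 : val y != set0 by apply: (lam_neq0 lF); case/andP: (valP y).
have dis : [disjoint ~: val x & val x] by rewrite -setI_eq0 setIC setICr.
by move: y0; rewrite yE uE => /(disjoint_neq0 dis)/negbTE->.
Qed.

Lemma rank_width_laminar : rank_width_of laminar_decomposition <= k.
Proof.
have main (x y : lnode) : ladj x y -> val y = up (val x) ->
    cut_rank (side (D := laminar_decomposition) x y)
             (side (D := laminar_decomposition) y x) <= k.
  move=> xy yE; rewrite (side_setC (D := laminar_decomposition) xy) side_laminar //.
  by apply: (lam_cut lF); case/andP: (valP x).
apply/bigmax_leqP=> -[x y] /= xy; have /orP[/eqP yE|/eqP xE] := xy; first exact: main.
by rewrite cut_rank_sym; apply: main; rewrite // /ladj up_adj_sym.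
Qed.

Hypothesis chainF : forall X Y, X \in F -> Y \in F ->
  1 < #|X| -> 1 < #|Y| -> X \subset Y \/ Y \subset X.

(** Internal nodes are the members with at least two vertices, which form a chain; sorted by size,
    consecutive ones are child and parent. *)
Lemma linear_laminar : linear_decomposition laminar_decomposition.
Proof.
pose p := sort (relpre (fun x : lnode => #|val x|) leq) (enum (internal ladj)).
have pU : uniq p by rewrite sort_uniq enum_uniq.
have pI : p =i internal ladj by move=> x; rewrite mem_sort mem_enum.
exists p; split=> // x0.
have p1 i : i < size p -> 1 < #|val (nth x0 p i)|.
  move=> /(mem_nth x0); rewrite pI.
  by rewrite -[_ \in _]/(internal ladj _) /internal ladj_leafE -ltnNge.
have pF i : val (nth x0 p i) \in F by case/andP: (valP (nth x0 p i)).
have pT i : val (nth x0 p i) != setT by case/andP: (valP (nth x0 p i)).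
have inc i j : i < size p -> j < size p -> i < j ->
    val (nth x0 p i) \proper val (nth x0 p j).
  move=> ip jp ij; have ne : val (nth x0 p i) != val (nth x0 p j).
    by rewrite val_eqE nth_uniq // ltn_eqF.
  have cij : #|val (nth x0 p i)| <= #|val (nth x0 p j)|.
    apply: (@sorted_leq_nth _ (relpre (fun x : lnode => #|val x|) leq)) => //.
    - by move=> y x z; apply: leq_trans.
    - by move=> x; apply: leqnn.
    - by apply: sort_sorted => x y; apply: leq_total.
    - exact: ltnW.
  rewrite properEneq ne; case: (chainF (pF i) (pF j) (p1 i ip) (p1 j jp)) => // ji.
  by case/eqP: ne; apply/eqP; rewrite eq_sym eqEcard ji.
have inc_inv i j : i < size p -> j < size p ->
    val (nth x0 p i) \proper val (nth x0 p j) -> i < j.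
  move=> ip jp pij; rewrite ltnNge leq_eqVlt; apply/negP=> /orP[/eqP E|ji].
    by rewrite E properxx in pij.
  by have := proper_trans pij (inc _ _ jp ip ji); rewrite properxx.
(* Two disjoint halves cannot both be in the chain, so here [up] is the parent, and no member lies
   strictly between consecutive ones. *)
have upE i j : i < size p -> j < size p ->
    (val (nth x0 p j) == up (val (nth x0 p i))) = (i.+1 == j).
  move=> ip jp; have ntI := valP (nth x0 p i).
  have [_ ipar pmin] := parentP ntI.
  apply/eqP/eqP => [jE|ijE].
    have [_ [[pr uE]|[uE _ _]]] := upP ntI.
      rewrite -jE in pr; have ij := inc_inv _ _ ip jp pr.
      apply/eqP; rewrite eqn_leq ij leqNgt; apply/negP=> ij1.
      have i1 : i.+1 < size p := ltn_trans ij1 jp.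
      have := pmin _ (pF i.+1) (inc _ _ ip i1 (ltnSn i)).
      rewrite -uE -jE => sub; have := sub_proper_trans sub (inc _ _ i1 jp ij1).
      by rewrite properxx.
    have dis : [disjoint val (nth x0 p i) & val (nth x0 p j)].
      by rewrite jE uE -setI_eq0 setICr.
    have [sub|sub] := chainF (pF i) (pF j) (p1 i ip) (p1 j jp).
      by case/negP: (disjoint_neq0 dis (lam_neq0 lF (pF i))).
    rewrite disjoint_sym in dis.
    by case/negP: (disjoint_neq0 dis (lam_neq0 lF (pF j))).
  have parj : parent (val (nth x0 p i)) \subset val (nth x0 p j).
    by apply: pmin (pF j) (inc _ _ ip jp _); rewrite -ijE.
  have parT : parent (val (nth x0 p i)) != setT.
    by apply: contraTneq parj => ->; rewrite subTset pT.
  have uE : up (val (nth x0 p i)) = parent (val (nth x0 p i)) by rewrite /up (negbTE parT).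
  have [ntU _] := upP ntI; have [u uV] := lnodeP ntU; rewrite uE in uV *.
  have uI : u \in p.
    rewrite pI -[_ \in _]/(internal ladj _) /internal ladj_leafE -ltnNge uV.
    exact: ltn_trans (p1 i ip) (proper_card ipar).
  rewrite -uV -[u](nth_index x0 uI); move: uI; rewrite -index_mem.
  set m := index u p => mp; have mE : nth x0 p m = u by rewrite nth_index // -index_mem.
  have im : i < m by apply: inc_inv => //; rewrite mE uV.
  suff -> : m = j by [].
  apply/eqP; rewrite eqn_leq -[j in _ && (j <= _)]ijE im andbT leqNgt; apply/negP=> jm.
  have := proper_sub_trans (inc _ _ jp mp jm); rewrite mE uV => /(_ _ parj).
  by rewrite properxx.
by move=> i j ip jp; rewrite /= /ladj /up_adj !upE.
Qed.

End Laminar.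

(** * The four inequalities *)

Section Bounds.
Variable G : sgraph.

Lemma rank_width_small (D : branch_decomposition G) : #|G| <= 1 -> rank_width_of D <= 1.
Proof.
move=> G1; apply/bigmax_leqP=> e _; apply: leq_trans (cut_rank_leq_card _ _) _.
exact: leq_trans (max_card _) G1.
Qed.

Lemma rw_leq_branched k : 1 < #|G| -> 0 < k -> branched k [set: G] -> rw G <= k.
Proof.
move=> G1 k0 /(branched_laminar k0)[F lF].
have [_ minD] := nat_minP (ex_rank_width G).
apply: leq_trans (rank_width_laminar lF G1); apply: minD.
by exists (laminar_decomposition lF G1).
Qed.

Lemma lrw_leq_layered k : 1 < #|G| -> 0 < k -> layered k [set: G] -> lrw G <= k.
Proof.
move=> G1 k0 lG; have T0 : [set: G] != set0 by rewrite -card_gt0 cardsT ltnW.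
have [F lF cF] := layered_laminar k0 lG T0.
have [_ minD] := nat_minP (ex_linear_rank_width G).
apply: leq_trans (rank_width_laminar lF G1); apply: minD.
by exists (laminar_decomposition lF G1) => //; apply: linear_laminar.
Qed.

Lemma branched_rw : 0 < #|G| -> branched (rw G) [set: G].
Proof.
rewrite leq_eqVlt => /orP[/eqP G1|G1].
  have /cards1P[x ->] : #|[set: G]| == 1 by rewrite cardsT -G1.
  exact: branched1.
have [[D DE] _] := nat_minP (ex_rank_width G).
by rewrite /rw -DE; apply: branched_rank_width.
Qed.

Lemma layered_lrw : 0 < #|G| -> layered (lrw G) [set: G].
Proof.
rewrite leq_eqVlt => /orP[/eqP G1|G1].
  have /cards1P[x xE] : #|[set: G]| == 1 by rewrite cardsT -G1.
  rewrite xE -(setU0 [set x]); apply: layeredU1; first exact: layered0.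
    by rewrite inE.
  by rewrite setU0 -xE cut_rank_setT.
have [[D lD DE] _] := nat_minP (ex_linear_rank_width G).
by rewrite /lrw -DE; apply: layered_linear.
Qed.

Lemma ltww0 : #|G| = 0 -> ltww G = 0.
Proof.
move=> G0; have [[P _ PE] _] := nat_minP (ex_component_width G).
by rewrite /ltww -PE /component_width G0 big_geq.
Qed.

Lemma ttww0 : #|G| = 0 -> ttww G = 0.
Proof.
move=> G0; have [[P _ PE] _] := nat_minP (ex_total_width G).
by rewrite /ttww -PE /total_width G0 big_geq.
Qed.

Lemma ltww_leq_rw : ltww G <= 2 ^ (rw G).+1.
Proof.
by have [/ltww0->//|G0] := posnP #|G|; apply: ltww_leq_branched (branched_rw G0).
Qed.

Lemma ttww_leq_lrw : ttww G <= (2 ^ lrw G).+1 ^ 2.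
Proof.
by have [/ttww0->//|G0] := posnP #|G|; apply: ttww_leq_layered (layered_lrw G0).
Qed.

Lemma rw_leq_ltww : rw G <= (ltww G).+1.
Proof.
have [G1|G1] := leqP #|G| 1; last by apply: rw_leq_branched (branched_ltww (ltnW G1)).
have [[D DE] _] := nat_minP (ex_rank_width G).
by rewrite /rw -DE; apply: leq_trans (rank_width_small D G1) _.
Qed.

Lemma lrw_leq_ttww : lrw G <= (2 * ttww G).+1.
Proof.
have [G1|G1] := leqP #|G| 1; last by apply: lrw_leq_layered (layered_ttww G1).
have [[D _ DE] _] := nat_minP (ex_linear_rank_width G).
by rewrite /lrw -DE; apply: leq_trans (rank_width_small D G1) _.
Qed.

End Bounds.

Theorem theorem1p1 :
  exists f : nat -> nat, forall G : sgraph,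
    [/\ ltww G <= f (rw G), rw G <= f (ltww G),
        ttww G <= f (lrw G) & lrw G <= f (ttww G)].
Proof.
(* The sum of the four bounds dominates each of them. *)
exists (fun k => 2 ^ k.+1 + k.+1 + (2 ^ k).+1 ^ 2 + (2 * k).+1) => G; split.
- by apply: leq_trans (ltww_leq_rw G) _; rewrite -!addnA leq_addr.
- by apply: leq_trans (rw_leq_ltww G) _; rewrite -!addnA addnCA leq_addr.
- by apply: leq_trans (ttww_leq_lrw G) _; rewrite -addnA addnCA leq_addr.
- by apply: leq_trans (lrw_leq_ttww G) _; rewrite leq_addl.
Qed.
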